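(* Let $m\ge 1$, let $p$ be an even positive integer, let $q_1,\dots,q_m$ be positive integers each coprime to $p$, and let $L=L(p;q_1,\dots,q_m)$ be the corresponding lens space, of dimension $2m-1$. For every odd positive integer $i$, put $\lambda_i=i(i+2m-2)$ and let $\dim(\lambda_i)$ be the dimension of the space of smooth functions $f$ on $L$ satisfying $\Delta f=\lambda_i f$. Then $\dim(\lambda_i)$ is even.
   Context: The lens space $L(p;q_1,\dots,q_m)$ is the quotient of the unit sphere $S^{2m-1}\subset\mathbb{C}^m$, with its round metric of constant curvature $1$, by the cyclic group of order $p$ generated by the isometry $(z_1,\dots,z_m)\mapsto(e^{2\pi \mathrm{i} q_1/p}z_1,\dots,e^{2\pi \mathrm{i} q_m/p}z_m)$ (here $\mathrm{i}=\sqrt{-1}$), with the induced Riemannian metric. $\Delta$ is the (nonnegative) Laplace–Beltrami operator acting on smooth complex-valued functions on $L$. Every eigenvalue of $\Delta$ is of the form $i(i+2m-2)$ with $i\ge 0$ an integer; if $\lambda_i$ is not an eigenvalue, then $\dim(\lambda_i)=0$. *)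

(* Defs.v *)
From HB Require Import structures.
From mathcomp Require Import all_boot all_order all_algebra.
From mathcomp Require Import generic_quotient complex.
From mathcomp Require Import all_classical all_reals all_analysis.

Set Implicit Arguments.
Unset Strict Implicit.
Unset Printing Implicit Defensive.

Import Order.TTheory GRing.Theory Num.Theory.
Import numFieldNormedType.Exports.

Local Open Scope classical_set_scope.
Local Open Scope ring_scope.
Local Open Scope complex_scope.
Local Open Scope quotient_scope.

Section Smooth.
Context {R : realType} {n : nat}.

Definition partial (a : 'I_n) (h : 'rV[R]_n -> R) (u : 'rV[R]_n) : R :=
  'D_(delta_mx 0 a) h u.

Fixpoint Ck (k : nat) (U : set 'rV[R]_n) (h : 'rV[R]_n -> R) : Prop :=
  (forall u, U u -> {for u, continuous h}) /\
  if k is k'.+1 then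
    (forall a u, U u -> derivable h u (delta_mx 0 a)) /\
    (forall a, Ck k' U (partial a h))
  else True.

Definition smooth (U : set 'rV[R]_n) (h : 'rV[R]_n -> R) : Prop :=
  forall k, Ck k U h.

End Smooth.

Section Sphere.
Context {R : realType} {m : nat}.

Definition on_sphere (z : 'rV[R[i]]_m) : bool := \sum_j `|z 0 j| ^+ 2 == 1.

Definition sphere : Type := {z : 'rV[R[i]]_m | on_sphere z}.

End Sphere.
Arguments sphere : clear implicits.

Section Lens.
Context {R : realType}.

Definition expi (t : R) : R[i] := cos t +i* sin t.

Lemma expiD s t : expi (s + t) = expi s * expi t.
Proof.
rewrite /expi cosD sinD; apply/eqP; rewrite eq_complex /= eqxx /=.
by rewrite addrC.
Qed.

Lemma normr_expi t : `|expi t| = 1.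
Proof. by rewrite normc_def /= cos2Dsin2 sqrtr1. Qed.

Lemma expi_2pi (k : nat) : expi (2 * pi * k%:R) = 1.
Proof.
elim: k => [|k IHk]; first by rewrite mulr0 /expi cos0 sin0.
rewrite -[k.+1%:R]natr1 mulrDr mulr1 expiD IHk mul1r.
by rewrite /expi mulr_natl cos2pi sin2pi.
Qed.

Lemma expiX t k : expi t ^+ k = expi (t *+ k).
Proof.
elim: k => [|k IHk]; first by rewrite expr0 mulr0n /expi cos0 sin0.
by rewrite exprS IHk mulrS expiD.
Qed.

Context {m : nat} (p : nat) (q : 'I_m -> nat).

Definition lens_phase (j : 'I_m) : R[i] := expi (2 * pi * (q j)%:R / p%:R).

Definition lens_rot_row (z : 'rV[R[i]]_m) : 'rV[R[i]]_m :=
  \row_j (lens_phase j * z 0 j).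

Lemma lens_rot_subproof (z : sphere R m) : on_sphere (lens_rot_row (val z)).
Proof.
have /eqP zS := valP z; apply/eqP; rewrite -[RHS]zS; apply: eq_bigr => j _.
by rewrite mxE normrM normr_expi mul1r.
Qed.

Definition lens_rot (z : sphere R m) : sphere R m :=
  exist _ (lens_rot_row (val z)) (lens_rot_subproof z).

(* The orbit relation of the cyclic group generated by [lens_rot]; as this
   generator has finite order, its nonnegative powers suffice. *)
Definition lens_rel (z w : sphere R m) : bool :=
  `[< exists k : nat, w = iter k lens_rot z >].

Lemma iter_lens_rotE k (z : sphere R m) j :
  val (iter k lens_rot z) 0 j = lens_phase j ^+ k * val z 0 j.
Proof.
elim: k => [|k IHk]; first by rewrite expr0 mul1r.
by rewrite iterS mxE IHk exprS mulrA.
Qed.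

Lemma lens_rot_order : exists2 N : nat, (0 < N)%N &
  forall z : sphere R m, iter N lens_rot z = z.
Proof.
have [p0|p_gt0] := posnP p.
  exists 1%N => // z; apply: val_inj; apply/rowP => j.
  rewrite iter_lens_rotE expr1 /lens_phase p0 invr0 mulr0.
  by rewrite /expi cos0 sin0 mul1r.
exists p => // z; apply: val_inj; apply/rowP => j.
rewrite iter_lens_rotE /lens_phase expiX -[_ *+ p]mulr_natr divfK.
  by rewrite expi_2pi mul1r.
by rewrite pnatr_eq0 -lt0n.
Qed.

Lemma lens_rel_refl : reflexive lens_rel.
Proof. by move=> z; apply/asboolP; exists 0%N. Qed.

Lemma lens_rel_trans : transitive lens_rel.
Proof.
move=> w z x /asboolP[k ->] /asboolP[l ->]; apply/asboolP.
by exists (l + k)%N; rewrite iterD.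
Qed.

Lemma lens_rel_sym : symmetric lens_rel.
Proof.
suff sub z w : lens_rel z w -> lens_rel w z.
  by move=> z w; apply/idP/idP; apply: sub.
move=> /asboolP[k ->]; apply/asboolP; have [N N_gt0 NE] := lens_rot_order.
exists (k * N.-1)%N; rewrite -iterD addnC -mulnS prednK //.
by elim: k => [//|k IHk]; rewrite mulSn iterD -IHk NE.
Qed.

Canonical lens_equiv :=
  EquivRel lens_rel lens_rel_refl lens_rel_sym lens_rel_trans.

Definition lens_space : Type := {eq_quot lens_equiv}.

Definition lens_proj (z : sphere R m) : lens_space := \pi_({eq_quot lens_equiv}) z.

End Lens.
Arguments lens_space R {m} p q.

Section LaplaceBeltrami.
Context {R : realType} {m : nat}.

Local Notation n := (2 * m).-1.

Definition re_coord (phi : 'rV[R]_n -> sphere R m) (j : 'I_m) (u : 'rV[R]_n) : R :=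
  complex.Re (val (phi u) 0 j).

Definition im_coord (phi : 'rV[R]_n -> sphere R m) (j : 'I_m) (u : 'rV[R]_n) : R :=
  complex.Im (val (phi u) 0 j).

(* The coefficients g_ab of the round metric, i.e. the Euclidean scalar
   products of the tangent vectors d phi / d u_a and d phi / d u_b in
   C^m = R^(2m). *)
Definition metric (phi : 'rV[R]_n -> sphere R m) (u : 'rV[R]_n) : 'M[R]_n :=
  \matrix_(a, b) \sum_j
    (partial a (re_coord phi j) u * partial b (re_coord phi j) u +
     partial a (im_coord phi j) u * partial b (im_coord phi j) u).

(* A Gram matrix is invertible exactly when the tangent vectors are independent:
   a local parametrization is a smooth immersion of an open subset of R^(2m-1)
   into the sphere, hence a local diffeomorphism. Injectivity is not required:
   smoothness and the Laplacian are local. The values of phi outside U are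
   irrelevant. *)
Definition local_param (U : set 'rV[R]_n) (phi : 'rV[R]_n -> sphere R m) : Prop :=
  [/\ open U,
      forall j, smooth U (re_coord phi j) /\ smooth U (im_coord phi j) &
      forall u, U u -> metric phi u \in unitmx].

(* The (nonnegative) Laplace-Beltrami operator in local coordinates:
   - (det g)^(-1/2) sum_a d_a ((det g)^(1/2) sum_b g^(ab) d_b h). *)
Definition local_laplacian (phi : 'rV[R]_n -> sphere R m) (h : 'rV[R]_n -> R)
    (u : 'rV[R]_n) : R :=
  - (Num.sqrt (\det (metric phi u)))^-1 *
  \sum_a partial a (fun v => Num.sqrt (\det (metric phi v)) *
           \sum_b invmx (metric phi v) a b * partial b h v) u.

Context (p : nat) (q : 'I_m -> nat).
Local Notation L := (lens_space R p q).

(* The projection of the sphere onto L is a local isometry for the induced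
   metric on L, so the maps lens_proj \o phi are local parametrizations of L in
   which that metric has the coefficients [metric phi]. *)

Definition pull_re (f : L -> R[i]^o) (phi : 'rV[R]_n -> sphere R m)
    (u : 'rV[R]_n) : R := complex.Re (f (lens_proj p q (phi u))).

Definition pull_im (f : L -> R[i]^o) (phi : 'rV[R]_n -> sphere R m)
    (u : 'rV[R]_n) : R := complex.Im (f (lens_proj p q (phi u))).

Definition lens_smooth (f : L -> R[i]^o) : Prop :=
  forall U phi, local_param U phi ->
    smooth U (pull_re f phi) /\ smooth U (pull_im f phi).

(* [is_laplacian f g] says that Delta f = g on L. *)
Definition is_laplacian (f g : L -> R[i]^o) : Prop :=
  forall U phi, local_param U phi -> forall u, U u ->
    g (lens_proj p q (phi u)) =
      local_laplacian phi (pull_re f phi) u +i*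
      local_laplacian phi (pull_im f phi) u.

Definition lens_eigenspace (lam : R[i]) : set (L -> R[i]^o) :=
  [set f | lens_smooth f /\ is_laplacian f (lam *: f)].

End LaplaceBeltrami.
Arguments lens_eigenspace {R m} p q lam.

(* E is a linear subspace of V of finite dimension d: it is the set of linear
   combinations of d linearly independent vectors. *)
Definition has_dim {K : fieldType} {V : lmodType K} (E : set V) (d : nat) : Prop :=
  exists b : 'I_d -> V,
    (forall c : 'I_d -> K, \sum_j c j *: b j = 0 -> forall j, c j = 0) /\
    (forall v, E v <-> exists c : 'I_d -> K, v = \sum_j c j *: b j).

(* Main.v *)
(** The group generated by the rotation contains [- 1], because [p] is even and
    every [q j] is odd; hence an eigenfunction [f] lifts to an even function on
    the sphere, and the eigenspace will turn out to be zero.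

    Extend the lift to [F x = |x|^i f (x / |x|)] on [R^(2m)] minus the origin:
    [F] is smooth, even, homogeneous of the odd degree [i] and, because of the
    value of the eigenvalue, harmonic.  Each partial derivative of such a function
    is harmonic, of degree one less and of the opposite parity, so by Euler's
    identity it suffices to show that an odd harmonic function of degree [0] is
    zero.  Its derivatives have degree [- 1]; in dimension at least [4] they vanish
    by the maximum principle, and in dimension [2] the rotational derivative of
    the function is constant and odd.  So the function has zero gradient and,
    being odd, vanishes. *)

Require Import Defs.
From HB Require Import structures.
From mathcomp Require Import all_boot all_order all_algebra complex generic_quotient.
From mathcomp Require Import all_classical all_reals all_analysis.
From mathcomp Require Import ring lra.

Set Implicit Arguments.
Unset Strict Implicit.
Unset Printing Implicit Defensive.

Import Order.TTheory GRing.Theory Num.Theory.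
Import numFieldNormedType.Exports.

Local Open Scope classical_set_scope.
Local Open Scope ring_scope.

(** * Differentiability from continuous partial derivatives *)

(** Harmonic functions homogeneous of degree [i] on the whole space are polynomials, hence have the
    parity of [i]. Here [F] is known only away from the origin; the descent through derivatives
    reaches the parity contradiction without extending [F] across 0 or producing a polynomial. The
    threshold 4 is sharp for degree -1: [1 / |x|] in dimension 3 and [x_a / |x|^2] in the plane are
    harmonic of that degree. The real dimension [2m] skips 3, and the plane is handled at degree 0,
    where oddness is still at hand. The eigenvalue equation holds in every local parametrization, so
    each point of the sphere may be taken as the centre of a stereographic chart and the equation
    read there only. At the centre the metric is 4 times the identity and its first derivatives
    vanish, so the Laplace-Beltrami operator is -1/4 times the sum of the pure second derivatives.
    Comparing this sum with the Euclidean Laplacian of [F] leaves the term [i (i + 2m - 2) F], which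
    the eigenvalue cancels. *)

Section Lines.
Context {R : realType} {V : normedModType R}.
Implicit Types (h : V -> R) (x v : V).

(** Both derivatives are limits of one and the same difference quotient. *)
Lemma is_derive_line h x v (t : R) :
  derivable h (x + t *: v) v ->
  is_derive t (1 : R) (fun s : R => h (x + s *: v)) ('D_v h (x + t *: v)).
Proof.
move=> dh.
have E : (fun k : R => k^-1 *: (((fun s : R => h (x + s *: v)) \o shift t) (k *: 1)
             - h (x + t *: v))) =
    (fun k : R => k^-1 *: ((h \o shift (x + t *: v)) (k *: v) - h (x + t *: v))).
  apply/funext => k /=; congr (_ *: (h _ - _)).
  by rewrite [k *: 1]mulr1 scalerDl addrCA.
by apply: DeriveDef; rewrite /derivable /derive E.
Qed.

(** The bound on [t] is symmetric, so that steps [s] of either sign are treated alike. *)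
Lemma MVT_line h x v (s : R) :
  (forall t : R, `|t| <= `|s| -> derivable h (x + t *: v) v) ->
  exists2 t : R, `|t| <= `|s| & h (x + s *: v) - h x = s * 'D_v h (x + t *: v).
Proof.
move=> dh.
have dg (t : R) : `|t| <= `|s| ->
    is_derive (t : R) (1 : R) (fun s : R => h (x + s *: v)) ('D_v h (x + t *: v)).
  by move=> /dh; apply: is_derive_line.
have cg (a b : R) : (forall t, t \in `[a, b] -> `|t| <= `|s|) ->
    {within `[a, b], continuous (fun s : R => h (x + s *: v))}.
  move=> H; apply: derivable_within_continuous => t /H /dg.
  by move=> [].
have [s0|s0] := leP 0 s.
  have H t : t \in `[0, s] -> `|t| <= `|s|.
    by rewrite in_itv/= => /andP[t0 ts]; rewrite !ger0_norm.
  have [t /H tI] := @MVT_segment R _ (fun t => 'D_v h (x + t *: v)) _ _ s0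
    (fun t ti => dg t (H t (subset_itv_oo_cc ti))) (cg _ _ H).
  by rewrite scale0r addr0 subr0 mulrC => E; exists t.
have H t : t \in `[s, 0] -> `|t| <= `|s|.
  rewrite in_itv/= => /andP[t0 ts]; rewrite !ler0_norm ?lerN2 //.
  exact: ltW.
have [t /H tI] := @MVT_segment R _ (fun t => 'D_v h (x + t *: v)) _ _ (ltW s0)
    (fun t ti => dg t (H t (subset_itv_oo_cc ti))) (cg _ _ H).
rewrite scale0r addr0 => E; exists t => //.
by rewrite -opprB E sub0r mulrN opprK mulrC.
Qed.

End Lines.

Section Partials.
Context {R : realType} {n : nat}.
Local Notation V := 'rV[R]_n.
Local Notation e a := (delta_mx 0 a : V).
Implicit Types (h : V -> R) (x v : V).

Lemma norm_delta_row (a : 'I_n) : `|e a| <= 1.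
Proof.
rewrite /Num.norm /= mx_normrE; apply: bigmax_le => //= -[i j] _ /=.
by rewrite mxE ger0_norm ?ler0n // lern1 leq_b1.
Qed.

Lemma norm_row_coord v (a : 'I_n) : `|v 0 a| <= `|v|.
Proof.
rewrite [leRHS]/Num.norm /= mx_normrE.
exact: (@le_bigmax _ _ _ _ (fun ij : 'I_1 * 'I_n => `|v ij.1 ij.2|) (0, a)).
Qed.

(** The increment [v] is split into one step per coordinate, and the mean value theorem evaluates
    each step at a point still close to [x]. *)
Lemma continuous_partial_increment h x :
  (forall a, \forall y \near x, derivable h y (e a)) ->
  (forall a, {for x, continuous (partial a h)}) ->
  forall eps : R, 0 < eps -> \forall v \near (0 : V),
    `|h (x + v) - h x - \sum_a v 0 a * partial a h x| <= eps * `|v|.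
Proof.
move=> dh ch eps eps0.
(* At most [n] steps share [eps], and their intermediate points lie within [(n + 1) |v|] of [x];
   dividing by [n + 1] serves both bounds and is safe for [n = 0]. *)
have n1 : 0 < n%:R + 1 :> R by rewrite ltr_pwDr.
have eps' : 0 < eps / (n%:R + 1) by rewrite divr_gt0.
have Hnear : \forall y \near x, forall a : 'I_n, derivable h y (e a) /\
    `|partial a h x - partial a h y| <= eps / (n%:R + 1).
  apply: (@filter_forall V 'I_n (fun a y => derivable h y (e a) /\
    `|partial a h x - partial a h y| <= eps / (n%:R + 1)) (nbhs x)) => a.
  apply: filterI; first exact: dh.
  by have /cvgrPdist_le /(_ _ eps') := ch a.
have /nbhs_ballP[d /= d0 Hd] := Hnear.
have d'0 : 0 < d / (n%:R + 1) by rewrite divr_gt0.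
apply/nbhs_ballP; exists (d / (n%:R + 1)) => //= v.
rewrite -ball_normE /= sub0r normrN => vd.
have key (s : seq 'I_n) : (size s <= n)%N ->
    `|h (x + \sum_(a <- s) v 0 a *: e a) - h x
      - \sum_(a <- s) v 0 a * partial a h x|
      <= (size s)%:R * (eps / (n%:R + 1) * `|v|) /\
    `|\sum_(a <- s) v 0 a *: e a| <= (size s)%:R * `|v|.
  elim: s => [|a s IH] /= sn.
    by rewrite !big_nil addr0 subrr subr0 !normr0 !mul0r lexx.
  have {IH} [IH1 IH2] := IH (ltnW sn).
  have term (t : R) : `|t| <= `|v 0 a| -> `|t *: e a| <= `|v|.
    move=> tv; rewrite normrZ (le_trans _ (norm_row_coord v a)) //.
    rewrite -[leRHS]mulr1; apply: ler_pM => //; exact: norm_delta_row.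
  split; last first.
    rewrite big_cons (le_trans (ler_normD _ _)) // mulrS mulrDl mul1r lerD //.
    exact: term.
  set w := \sum_(a <- s) _ in IH1 IH2 *.
  have inball (t : R) : `|t| <= `|v 0 a| -> ball x d (x + w + t *: e a).
    move=> /term tv; rewrite -ball_normE /= -addrA opprD addNKr normrN.
    apply: le_lt_trans (ler_normD _ _) _.
    apply: (@le_lt_trans _ _ ((n%:R + 1) * `|v|)).
      rewrite mulrDl mul1r lerD // (le_trans IH2) // ler_wpM2r //.
      by rewrite ler_nat ltnW.
    by rewrite mulrC -ltr_pdivlMr.
  have [t /inball tB E] : exists2 t : R, `|t| <= `|v 0 a| &
      h (x + w + v 0 a *: e a) - h (x + w) =
      v 0 a * 'D_(e a) h (x + w + t *: e a).
    by apply: MVT_line => t /inball /Hd /(_ a) [].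
  have [_ pd] := Hd _ tB a.
  rewrite !big_cons -/w.
  have -> : h (x + (v 0 a *: e a + w)) = h (x + w) +
      v 0 a * 'D_(e a) h (x + w + t *: e a).
    by rewrite -E addrA addrAC addrCA subrr addr0.
  set S := \sum_(_ <- _) _ in IH1 *.
  have -> : h (x + w) + v 0 a * 'D_(e a) h (x + w + t *: e a) - h x -
      (v 0 a * partial a h x + S) =
      (h (x + w) - h x - S) -
      v 0 a * (partial a h x - partial a h (x + w + t *: e a)).
    rewrite /partial; ring.
  rewrite (le_trans (ler_normB _ _)) // mulrS mulrDl mul1r addrC lerD //.
  by rewrite normrM mulrC ler_pM // norm_row_coord.
have [] := key (index_enum 'I_n).
  by rewrite -[index_enum _]enumT size_enum_ord.
rewrite -row_sum_delta => kn _; rewrite (le_trans kn) //.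
rewrite mulrA ler_wpM2r //.
rewrite mulrCA -[leRHS]mulr1 ler_wpM2l ?ltW //.
rewrite ltr_pdivrMr // mul1r -[index_enum _]enumT size_enum_ord.
by rewrite ltrDl.
Qed.

Lemma continuous_partial_differentiable h x :
  (forall a, \forall y \near x, derivable h y (e a)) ->
  (forall a, {for x, continuous (partial a h)}) ->
  differentiable h x /\
  forall v, 'd h x v = \sum_a v 0 a * partial a h x.
Proof.
move=> dh ch.
pose D v : R := \sum_a v 0 a * partial a h x.
have Dlin : linear D.
  move=> k u v; rewrite /D scaler_sumr -big_split; apply: eq_bigr => a _ /=.
  by rewrite !mxE mulrDl -[k *: _]/(k * _) mulrA.
pose D' : {linear V -> R} := HB.pack D (GRing.isLinear.Build _ _ _ _ D Dlin).
have cD : continuous D'.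
  apply/linear_bounded_continuous/linear_boundedP.
  near=> K => v.
  have KM : \sum_a `|partial a h x| <= K by near: K; apply: nbhs_pinfty_ge; exact: num_real.
  rewrite (le_trans (ler_norm_sum _ _ _)) //.
  apply: (@le_trans _ _ ((\sum_a `|partial a h x|) * `|v|)).
    rewrite mulr_suml ler_sum // => a _; rewrite normrM mulrC ler_wpM2l //.
    exact: norm_row_coord.
  exact: ler_wpM2r.
have E := @diff_unique R V R h D' x cD.
match type of E with ?A -> _ => assert (E' : A) end.
  apply/eqaddoP => eps eps0.
  have := continuous_partial_increment dh ch eps0.
  by apply: filter_app; near=> v; rewrite [x + v]addrC -addrA -opprD.
have {}E := E E'.
split; last by move=> v; rewrite E.
by apply/diff_locallyP; rewrite E.
Unshelve. all: by end_near. Qed.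

End Partials.

(** * Closure properties of [Ck] *)

Section DeriveComp.
Context {R : realType} {V : normedModType R}.

(** Restricting to the line through [u] reduces this to the one-variable chain rule, so [f] need be
    derivable only along [v]. *)
Lemma is_derive_comp1 (phi : R -> R) (f : V -> R) (u v : V) (d : R) :
  is_derive (f u) (1 : R) phi d -> derivable f u v ->
  is_derive u v (fun w => phi (f w)) (d * 'D_v f u).
Proof.
move=> dphi df.
have : derivable f (u + (0 : R) *: v) v by rewrite scale0r addr0.
move=> /is_derive_line; rewrite scale0r addr0.
set g := (fun s : R => f (u + s *: v)) => dg.
have g0 : g 0 = f u by rewrite /g scale0r addr0.
have dphi' : is_derive (g 0) (1 : R) phi d by rewrite g0.
have [dc cE] := is_derive1_comp dphi' dg.
have E : (fun k : R => k^-1 *: (((fun w => phi (f w)) \o shift u) (k *: v)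
             - phi (f u))) =
    (fun k : R => k^-1 *: (((phi \o g) \o shift 0) (k *: 1) - (phi \o g) 0)).
  apply/funext => k /=; rewrite g0; congr (_ *: (phi _ - _)).
  by rewrite /g addr0 [k *: 1]mulr1 addrC.
apply: DeriveDef; first by rewrite /derivable E.
by rewrite -cE /derive E.
Qed.

Lemma is_derive_sqrt (f : V -> R) (u v : V) : 0 < f u -> derivable f u v ->
  is_derive u v (fun w => Num.sqrt (f w))
    ((2 * Num.sqrt (f u))^-1 * 'D_v f u).
Proof. by move=> f0 df; apply: is_derive_comp1 => //; exact: is_derive1_sqrt. Qed.

End DeriveComp.

Section CkBasics.
Context {R : realType} {n : nat}.
Local Notation V := 'rV[R]_n.
Local Notation e a := (delta_mx 0 a : V).
Implicit Types (h : V -> R) (U : set V) (k : nat).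

Lemma Ck_continuous k U h : Ck k U h -> forall u, U u -> {for u, continuous h}.
Proof. by case: k => [|k] []. Qed.

Lemma Ck_derivable k U h : Ck k.+1 U h ->
  forall a u, U u -> derivable h u (e a).
Proof. by case=> _ []. Qed.

Lemma Ck_partial k U h : Ck k.+1 U h -> forall a, Ck k U (partial a h).
Proof. by case=> _ []. Qed.

Lemma CkW k U h : Ck k.+1 U h -> Ck k U h.
Proof.
elim: k h => [|k IH] h [ch [dh Dh]]; split=> //.
by split=> // a; apply: IH.
Qed.

(** [Ck] evaluates ambient derivatives at the points of [U], so it makes sense on a singleton. This
    allows smoothness to be proved with a different chart at each point. *)
Lemma Ck_pointwise k U h : (forall u, U u -> Ck k [set u] h) -> Ck k U h.
Proof.
elim: k h => [|k IH] h H.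
  by split=> // u Uu; apply: (Ck_continuous (H u Uu)).
split; first by move=> u Uu; apply: (Ck_continuous (H u Uu)).
split; first by move=> a u Uu; apply: (Ck_derivable (H u Uu)).
by move=> a; apply: IH => u Uu; apply: (Ck_partial (H u Uu)).
Qed.

Lemma Ck_subset k U U' h : U `<=` U' -> Ck k U' h -> Ck k U h.
Proof.
move=> UU'; elim: k h => [|k IH] h H.
  by split=> // u /UU'; exact: (Ck_continuous H).
split; first by move=> u /UU'; exact: (Ck_continuous H).
split=> [a u /UU'|a]; first exact: (Ck_derivable H).
by apply: IH; exact: (Ck_partial H).
Qed.

Section Open.
Variables (U : set V).
Hypothesis openU : open U.

Lemma eq_on_near h h' u : {in U, h =1 h'} -> U u -> \near u, h u = h' u.
Proof.
move=> hh' Uu; have := open_nbhs_nbhs (conj openU Uu).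
by apply: filter_app; near=> v => Uv; apply: hh'; rewrite inE.
Unshelve. all: by end_near. Qed.

Lemma partial_eq_on h h' a u : {in U, h =1 h'} -> U u ->
  partial a h u = partial a h' u.
Proof. by move=> hh' Uu; apply/near_eq_derive/eq_on_near. Qed.

Lemma continuous_eq_on h h' u : {in U, h =1 h'} -> U u ->
  {for u, continuous h} -> {for u, continuous h'}.
Proof.
move=> hh' Uu ch; have E : h u = h' u by apply: hh'; rewrite inE.
have : h @ u --> h' u by rewrite -E; exact: ch.
apply: cvg_trans; apply: (@near_eq_cvg _ _ (nbhs u)).
exact: eq_on_near.
Qed.

Lemma Ck_eq_on k h h' : {in U, h =1 h'} -> Ck k U h -> Ck k U h'.
Proof.
elim: k h h' => [|k IH] h h' hh' Ch.
  split=> // u Uu; apply: (continuous_eq_on hh') => //.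
  exact: (Ck_continuous Ch).
split.
  by move=> u Uu; apply: (continuous_eq_on hh') => //; exact: (Ck_continuous Ch).
split=> [a u Uu|a].
  exact: near_eq_derivable (eq_on_near hh' Uu) (Ck_derivable Ch Uu).
by apply: IH (Ck_partial Ch a) => u; rewrite inE => Uu; apply: partial_eq_on.
Qed.

Lemma C1_differentiable h u : Ck 1 U h -> U u ->
  differentiable h u /\ forall v, 'd h u v = \sum_a v 0 a * partial a h u.
Proof.
move=> Ch Uu; apply: continuous_partial_differentiable => a; last first.
  exact: (Ck_continuous (Ck_partial Ch a)).
have := open_nbhs_nbhs (conj openU Uu); apply: filter_app.
by near=> v => Uv; apply: (Ck_derivable Ch).
Unshelve. all: by end_near. Qed.

Lemma Ck_cst k c : Ck k U (fun=> c).
Proof.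
elim: k c => [|k IH] c; first by split=> // u _; exact: cst_continuous.
split; first by move=> u _; exact: cst_continuous.
split=> [a u _|a]; first exact: derivable_cst.
have -> : partial a (fun=> c) = (fun=> 0 : R) by apply/funext => u; exact: derive_cst.
exact: IH.
Qed.

Lemma CkD k h h' : Ck k U h -> Ck k U h' -> Ck k U (fun u => h u + h' u).
Proof.
elim: k h h' => [|k IH] h h'.
  by case=> ch _ [ch' _]; split=> // u Uu; apply: continuousD; [exact: ch|exact: ch'].
case=> ch [dh Dh] [ch' [dh' Dh']]; split.
  by move=> u Uu; apply: continuousD; [exact: ch|exact: ch'].
split=> [a u Uu|a]; first by apply: derivableD; [exact: dh|exact: dh'].
apply: Ck_eq_on (IH _ _ (Dh a) (Dh' a)) => u; rewrite inE => Uu.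
by rewrite /partial deriveD //; [exact: dh|exact: dh'].
Qed.

Lemma CkM k h h' : Ck k U h -> Ck k U h' -> Ck k U (fun u => h u * h' u).
Proof.
elim: k h h' => [|k IH] h h'.
  by case=> ch _ [ch' _]; split=> // u Uu; apply: continuousM; [exact: ch|exact: ch'].
move=> Ch Ch'; have [ch [dh Dh]] := Ch; have [ch' [dh' Dh']] := Ch'; split.
  by move=> u Uu; apply: continuousM; [exact: ch|exact: ch'].
split=> [a u Uu|a]; first by apply: derivableM; [exact: dh|exact: dh'].
apply: Ck_eq_on (CkD (IH _ _ (CkW Ch) (Dh' a)) (IH _ _ (CkW Ch') (Dh a))).
move=> u; rewrite inE => Uu.
by rewrite /partial deriveM //; [exact: dh|exact: dh'].
Qed.

Lemma Ck_sum k I (r : seq I) (h : I -> V -> R) :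
  (forall i, Ck k U (h i)) -> Ck k U (fun u => \sum_(i <- r) h i u).
Proof.
move=> Ch; elim: r => [|i r IH].
  by under eq_fun do rewrite big_nil; exact: Ck_cst.
by under eq_fun do rewrite big_cons; exact: CkD.
Qed.

Lemma CkX k j h : Ck k U h -> Ck k U (fun u => h u ^+ j).
Proof.
move=> Ch; elim: j => [|j IH].
  by under eq_fun do rewrite expr0; exact: Ck_cst.
by under eq_fun do rewrite exprS; exact: CkM.
Qed.

Lemma CkN k h : Ck k U h -> Ck k U (fun u => - h u).
Proof.
move=> Ch; have : Ck k U (fun u => -1 * h u) by apply: CkM => //; exact: Ck_cst.
by under eq_fun do rewrite mulN1r.
Qed.

Lemma CkB k h h' : Ck k U h -> Ck k U h' -> Ck k U (fun u => h u - h' u).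
Proof. by move=> Ch Ch'; apply: CkD => //; exact: CkN. Qed.

(** The derivative [- h' / h^2] is a product of copies of [1 / h] and of [h'], so regularity of
    [1 / h] at order [k] yields order [k + 1]. *)
Lemma CkV k h : (forall u, U u -> h u != 0) -> Ck k U h ->
  Ck k U (fun u => (h u)^-1).
Proof.
move=> h0; elim: k => [|k IH].
  by case=> ch _; split=> // u Uu; apply: continuousV; [exact: h0|exact: ch].
move=> Ch; have [ch [dh Dh]] := Ch; split.
  by move=> u Uu; apply: continuousV; [exact: h0|exact: ch].
split=> [a u Uu|a]; first by apply: derivableV; [exact: h0|exact: dh].
apply: Ck_eq_on (CkN (CkM (CkX 2 (IH (CkW Ch))) (Dh a))) => u; rewrite inE => Uu.
rewrite /partial deriveV ?h0 //; last exact: dh.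
by rewrite -exprVn -[_ *: _]/(_ * _) mulNr.
Qed.

(** Same bootstrap as for the inverse: the derivative is [h' / (2 sqrt h)], whose regularity follows
    from that of [sqrt h] one order lower. *)
Lemma Ck_sqrt k h : (forall u, U u -> 0 < h u) -> Ck k U h ->
  Ck k U (fun u => Num.sqrt (h u)).
Proof.
move=> h0; elim: k => [|k IH].
  by case=> ch _; split=> // u Uu; apply: continuous_comp; [exact: ch|exact: sqrt_continuous].
move=> Ch; have [ch [dh Dh]] := Ch; split.
  by move=> u Uu; apply: continuous_comp; [exact: ch|exact: sqrt_continuous].
split=> [a u Uu|a]; first by have [] := is_derive_sqrt (h0 u Uu) (dh a u Uu).
have Cs : Ck k U (fun u => (2 * Num.sqrt (h u))^-1).
  apply: CkV; last by apply: CkM; [exact: Ck_cst|exact: IH (CkW Ch)].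
  by move=> u Uu; rewrite mulf_neq0 ?pnatr_eq0 // gt_eqF // sqrtr_gt0 h0.
apply: Ck_eq_on (CkM Cs (Dh a)) => u; rewrite inE => Uu.
by have [_ E] := is_derive_sqrt (h0 u Uu) (dh a u Uu); rewrite /partial E.
Qed.

End Open.

Lemma derivable_coord_row (b a : 'I_n) u : derivable (fun v : V => v 0 b) u (e a).
Proof. by apply: diff_derivable; apply: differentiable_coord. Qed.

Lemma partial_coord (b a : 'I_n) u : partial a (fun v : V => v 0 b) u = (a == b)%:R.
Proof.
have /(congr1 (fun M : V => M 0 b)) := derive_mx (@derivable_id R V u (e a)).
by rewrite derive_id !mxE eqxx /= eq_sym.
Qed.

Lemma Ck_coord U k (b : 'I_n) : open U -> Ck k U (fun v : V => v 0 b).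
Proof.
move=> oU; case: k => [|k]; first by split=> // u _; exact: coord_continuous.
split; first by move=> u _; exact: coord_continuous.
split=> [a u _|a]; first exact: derivable_coord_row.
rewrite (_ : partial _ _ = fun=> (a == b)%:R); first exact: Ck_cst.
by apply/funext => u; exact: partial_coord.
Qed.

End CkBasics.

(** * The chain rule for maps between spaces of row vectors *)

Section CkComp.
Context {R : realType} {n p : nat}.
Variables (U : set 'rV[R]_n) (W : set 'rV[R]_p).
Hypotheses (openU : open U) (openW : open W).

Lemma differentiable_row (s : 'I_p -> 'rV[R]_n -> R) u v :
  (forall b, differentiable (s b) u) ->
  differentiable (fun u => \row_b s b u) u /\
  'D_v (fun u => \row_b s b u : 'rV_p) u = \row_b 'D_v (s b) u.
Proof.
move=> ds.
have dr : differentiable (fun u => \row_b s b u : 'rV_p) u.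
  rewrite (_ : (fun u => _) =
      \sum_(b < p) (fun u => s b u *: (delta_mx 0 b : 'rV_p))).
    by apply: differentiable_sum => b; apply: differentiableZl.
  apply/funext => w; rewrite fct_sumE [LHS]row_sum_delta.
  by apply: eq_bigr => b _; rewrite mxE.
split=> //; rewrite derive_mx; last exact: diff_derivable.
apply/rowP => b; rewrite !mxE; congr ('D_v _ u).
by apply/funext => w; rewrite mxE.
Qed.

Lemma partial_comp (G : 'rV[R]_p -> R) (s : 'I_p -> 'rV[R]_n -> R) a u :
  (forall b, Ck 1 U (s b)) -> Ck 1 W G -> U u -> W (\row_b s b u) ->
  derivable (fun u => G (\row_b s b u)) u (delta_mx 0 a) /\
  partial a (fun u => G (\row_b s b u)) u =
    \sum_b partial b G (\row_b s b u) * partial a (s b) u.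
Proof.
move=> Cs CG Uu Wu.
have ds b : differentiable (s b) u by have [] := C1_differentiable openU (Cs b) Uu.
have [dG GE] := C1_differentiable openW CG Wu.
have [dr rE] := differentiable_row (delta_mx 0 a) ds.
have dc := differentiable_comp dr dG.
split; first exact: diff_derivable.
rewrite /partial (deriveE _ dc) (diff_comp dr dG) /= GE -(deriveE _ dr) rE.
by apply: eq_bigr => b _; rewrite mxE mulrC.
Qed.

(* Asking one more derivative of [s] than of [G] makes the case [k = 0] a
   consequence of the differentiability of [s]. *)
Lemma Ck_comp k (G : 'rV[R]_p -> R) (s : 'I_p -> 'rV[R]_n -> R) :
  (forall b, Ck k.+1 U (s b)) -> Ck k W G ->
  (forall u, U u -> W (\row_b s b u)) ->
  Ck k U (fun u => G (\row_b s b u)).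
Proof.
move=> + + sUW; elim: k G => [|k IH] G Cs CG.
  have cc u : U u -> {for u, continuous (fun u => G (\row_b s b u))}.
    move=> Uu.
    apply: (@continuous_comp _ _ _ (fun u => \row_b s b u : 'rV_p)).
      apply: differentiable_continuous; apply: (differentiable_row 0 _).1 => b.
      by have [] := C1_differentiable openU (Cs b) Uu.
    by apply: (Ck_continuous CG); exact: sUW.
  by split.
have C1 n' k' (A : set 'rV[R]_n') h : Ck k'.+1 A h -> Ck 1 A h.
  by elim: k' => // k' IH' /CkW.
have Cs1 b : Ck 1 U (s b) := C1 _ _ _ _ (Cs b).
have CG1 := C1 _ _ _ _ CG.
have pc a u (Uu : U u) := partial_comp a Cs1 CG1 Uu (sUW u Uu).
split.
  move=> u Uu.
  apply: (@continuous_comp _ _ _ (fun u => \row_b s b u : 'rV_p)).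
    apply: differentiable_continuous; apply: (differentiable_row 0 _).1 => b.
    by have [] := C1_differentiable openU (Cs1 b) Uu.
  by apply: (Ck_continuous CG); exact: sUW.
split=> [a u Uu|a]; first by have [] := pc a u Uu.
have : Ck k U (fun u => \sum_b partial b G (\row_b s b u) * partial a (s b) u).
  apply: Ck_sum => // b; apply: CkM => //.
    by apply: IH => [b'|]; [exact: CkW|exact: (Ck_partial CG)].
  exact/CkW/(Ck_partial (Cs b)).
by apply: Ck_eq_on => // u; rewrite inE => Uu; have [_ ->] := pc a u Uu.
Qed.

End CkComp.

(** * Symmetry of second derivatives and the second derivative test *)

Section SecondOrder.
Context {R : realType} {n : nat}.
Local Notation V := 'rV[R]_n.
Local Notation e a := (delta_mx 0 a : V).
Implicit Types (h : V -> R) (x v : V) (U : set V).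

Lemma is_derive_translate h x v w : derivable h (x + w) v ->
  is_derive x v (fun y => h (y + w)) ('D_v h (x + w)).
Proof.
move=> dh.
have E : (fun k : R => k^-1 *: (((fun y => h (y + w)) \o shift x) (k *: v)
             - h (x + w))) =
    (fun k : R => k^-1 *: ((h \o shift (x + w)) (k *: v) - h (x + w))).
  by apply/funext => k /=; rewrite addrA.
by apply: DeriveDef; rewrite /derivable /derive E.
Qed.

(** The mean value theorem is applied along [a] to the increment of [h] in direction [b], then along
    [b]. The left-hand side is symmetric in [a] and [b], which gives [partialC]; for [a = b] it
    drives the second derivative test. *)
Lemma second_difference U h x (s : R) (a b : 'I_n) : Ck 2 U h ->
  (forall t t' : R, `|t| <= `|s| -> `|t'| <= `|s| ->
     U (x + t *: e a + t' *: e b)) ->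
  exists t t' : R, [/\ `|t| <= `|s|, `|t'| <= `|s| &
    h (x + s *: e a + s *: e b) - h (x + s *: e a) - (h (x + s *: e b) - h x) =
    s * (s * partial b (partial a h) (x + t *: e a + t' *: e b))].
Proof.
move=> Ch Ux.
have s0 : `|0 : R| <= `|s| by rewrite normr0.
pose phi y := h (y + s *: e b) - h y.
have dphi (t : R) : `|t| <= `|s| -> is_derive (x + t *: e a) (e a) phi
    (partial a h (x + t *: e a + s *: e b) - partial a h (x + t *: e a)).
  move=> ts; apply: is_deriveB.
    by apply: is_derive_translate; apply: (Ck_derivable Ch); exact: Ux.
  apply: derivableP; apply: (Ck_derivable Ch).
  by have := Ux t 0 ts s0; rewrite scale0r addr0.
have [t ts Et] : exists2 t : R, `|t| <= `|s| &
    phi (x + s *: e a) - phi x = s * 'D_(e a) phi (x + t *: e a).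
  by apply: MVT_line => t /dphi [].
have [t' t's Et'] : exists2 t' : R, `|t'| <= `|s| &
    partial a h (x + t *: e a + s *: e b) - partial a h (x + t *: e a) =
    s * 'D_(e b) (partial a h) (x + t *: e a + t' *: e b).
  apply: MVT_line => t' t's; apply: (Ck_derivable (Ck_partial Ch a)); exact: Ux.
exists t, t'; split=> //.
by rewrite -/(phi _) -/(phi _) Et (@derive_val _ _ _ _ _ _ _ (dphi t ts)) Et'.
Qed.

Lemma norm_scale_delta (t : R) (a : 'I_n) : `|t *: e a| <= `|t|.
Proof. by rewrite normrZ -[leRHS]mulr1 ler_wpM2l // norm_delta_row. Qed.

Lemma partialC U h x (a b : 'I_n) : open U -> Ck 2 U h -> U x ->
  partial a (partial b h) x = partial b (partial a h) x.
Proof.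
move=> oU Ch Ux; apply/eqP; rewrite -subr_eq0 -normr_le0.
apply/ler_addgt0Pr => eps eps0; rewrite add0r.
have eps2 : 0 < eps / 2 by rewrite divr_gt0.
have near_c c d : \forall y \near x, U y /\
    `|partial c (partial d h) x - partial c (partial d h) y| <= eps / 2.
  apply: filterI; first exact: open_nbhs_nbhs.
  have /= /cvgrPdist_le := Ck_continuous (Ck_partial (Ck_partial Ch d) c) Ux.
  by move=> /(_ _ eps2).
pose P c d y := U y /\
  `|partial c (partial d h) x - partial c (partial d h) y| <= eps / 2.
have near_cc : \forall y \near x, P a b y /\ P b a y.
  exact: (filterI (near_c a b) (near_c b a)).
have /nbhs_ballP[d /= d0 Hd] := near_cc.
pose s := d / 4.
have s0 : 0 < s by rewrite divr_gt0.
have inb c c' (t t' : R) : `|t| <= `|s| -> `|t'| <= `|s| ->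
    ball x d (x + t *: e c + t' *: e c').
  move=> ts t's; rewrite -ball_normE /= -addrA opprD addNKr normrN.
  rewrite (le_lt_trans (ler_normD _ _)) //.
  have := le_trans (norm_scale_delta t c) ts.
  have := le_trans (norm_scale_delta t' c') t's.
  rewrite (gtr0_norm s0) /s; move: d0; lra.
have [t [t' [ts t's E1]]] := second_difference Ch
  (fun t t' le1 le2 => (Hd _ (inb a b t t' le1 le2)).1.1).
have [r [r' [rs r's E2]]] := second_difference Ch
  (fun t t' le1 le2 => (Hd _ (inb b a t t' le1 le2)).1.1).
(* Exchanging the directions leaves the second difference unchanged. Cancelling [s] twice equates
   two mixed derivatives, each within [eps / 2] of its value at [x]. *)
have EE : partial b (partial a h) (x + t *: e a + t' *: e b) =
    partial a (partial b h) (x + r *: e b + r' *: e a).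
  apply: (mulfI (lt0r_neq0 s0)); apply: (mulfI (lt0r_neq0 s0)).
  apply: etrans (esym E1) _; apply: etrans _ E2; rewrite (addrAC x (s *: e b)).
  move: (h _) (h (x + s *: e a)) (h (x + s *: e b)) (h x) => h1 h2 h3 h4.
  by rewrite !opprB addrACA [RHS]addrACA [- h2 + _]addrC.
have [_ [_ H1]] := Hd _ (inb a b t t' ts t's).
have [[_ H2] _] := Hd _ (inb b a r r' rs r's).
rewrite (splitr eps).
set A := partial a _ x in H2 *; set B := partial b _ x in H1 *.
rewrite EE in H1; set C := partial a _ _ in H1 H2; clearbody A B C.
have -> : A - B = (A - C) - (B - C) by ring.
exact: le_trans (ler_normB _ _) (lerD H2 H1).
Qed.

Lemma second_partial_at_max U h x (a : 'I_n) : open U -> Ck 2 U h -> U x ->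
  (forall y, U y -> h y <= h x) -> partial a (partial a h) x <= 0.
Proof.
move=> oU Ch Ux hmax.
apply/ler_addgt0Pr => eps eps0; rewrite add0r.
have near_c : \forall y \near x, U y /\
    `|partial a (partial a h) x - partial a (partial a h) y| <= eps.
  apply: filterI; first exact: open_nbhs_nbhs.
  have /= /cvgrPdist_le := Ck_continuous (Ck_partial (Ck_partial Ch a) a) Ux.
  by move=> /(_ _ eps0).
have /nbhs_ballP[d /= d0 Hd] := near_c.
pose s := d / 4.
have s0 : 0 < s by rewrite divr_gt0.
(* Basing the second difference at [x - s e_a] puts [x] in the middle: it becomes
   [h (x + s e_a) - 2 h x + h (x - s e_a)], which is nonpositive. Three steps of length [d / 4] stay
   in the ball. *)
have inb (t t' : R) : `|t| <= `|s| -> `|t'| <= `|s| ->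
    ball x d (x - s *: e a + t *: e a + t' *: e a).
  move=> ts t's; rewrite -ball_normE /= -!addrA opprD addNKr normrN.
  rewrite (le_lt_trans (ler_normD _ _)) // normrN.
  have := ler_normD (t *: e a) (t' *: e a).
  have := le_trans (norm_scale_delta t a) ts.
  have := le_trans (norm_scale_delta t' a) t's.
  have := norm_scale_delta s a.
  rewrite (gtr0_norm s0) /s; move: d0; lra.
have [t [t' [ts t's]]] := second_difference Ch
  (fun t t' le1 le2 => (Hd _ (inb t t' le1 le2)).1).
rewrite subrK => E.
have [_ H1] := Hd _ (inb t t' ts t's).
have H2 : h (x + s *: e a) <= h x.
  apply: hmax; have [+ _] := Hd _ (inb s s (lexx _) (lexx _)).
  by rewrite subrK.
have H3 : h (x - s *: e a) <= h x.
  apply: hmax.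
  have z0 : `|0 : R| <= `|s| by rewrite normr0.
  have [+ _] := Hd _ (inb 0 0 z0 z0).
  by rewrite !scale0r !addr0.
set D := partial a _ x in H1 *.
set C := partial a _ _ in E H1; clearbody C D.
have C0 : C <= 0.
  rewrite leNgt; apply/negP => C0.
  have : 0 < s * (s * C) by rewrite !mulr_gt0.
  rewrite -E; move: H2 H3; lra.
have := ler_norm (D - C).
move: H1 C0; lra.
Qed.

End SecondOrder.

(** * Homogeneous functions on punctured space *)

Section Punctured.
Context {R : realType} {n : nat}.
Local Notation V := 'rV[R]_n.
Local Notation e a := (delta_mx 0 a : V).
Local Notation U0 := [set x : V | x != 0].
Implicit Types (F G : V -> R) (x : V).

Lemma open_punctured : open U0.
Proof.
rewrite (_ : U0 = ~` [set 0]); first 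
  exact/closed_openC/accessible_closed_set1/hausdorff_accessible/norm_hausdorff.
by apply/seteqP; split=> x /= x0; apply/eqP.
Qed.

Lemma smooth_partial U F a : smooth U F -> smooth U (partial a F).
Proof. by move=> sF k; exact: Ck_partial (sF k.+1) a. Qed.

Section Rules.
Variables (U : set V) (F G : V -> R) (a : 'I_n) (x : V).
Hypotheses (sF : smooth U F) (sG : smooth U G) (Ux : U x).

Lemma partialD : partial a (fun u => F u + G u) x = partial a F x + partial a G x.
Proof.
exact: deriveD (Ck_derivable (sF 1%N) Ux) (Ck_derivable (sG 1%N) Ux).
Qed.

Lemma partialB : partial a (fun u => F u - G u) x = partial a F x - partial a G x.
Proof.
exact: deriveB (Ck_derivable (sF 1%N) Ux) (Ck_derivable (sG 1%N) Ux).
Qed.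

Lemma partialM : partial a (fun u => F u * G u) x =
  F x * partial a G x + G x * partial a F x.
Proof.
exact: deriveM (Ck_derivable (sF 1%N) Ux) (Ck_derivable (sG 1%N) Ux).
Qed.

End Rules.

Lemma partial_sum U I (r : seq I) (F : I -> V -> R) a x :
  open U -> (forall i, smooth U (F i)) -> U x ->
  partial a (fun u => \sum_(i <- r) F i u) x = \sum_(i <- r) partial a (F i) x.
Proof.
move=> oU sF Ux; elim: r => [|i r IH].
  by under eq_fun do rewrite big_nil; rewrite big_nil; exact: derive_cst.
under eq_fun do rewrite big_cons.
rewrite big_cons -IH; apply: partialD Ux => //.
by move=> k; apply: Ck_sum => // j; exact: sF.
Qed.

Definition laplacian F x : R := \sum_a partial a (partial a F) x.

Lemma scale_neq0 (r : R) x : r != 0 -> x != 0 -> r *: x != 0.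
Proof. by move=> r0 x0; rewrite scaler_eq0 negb_or r0. Qed.

(** Positive factors give the homogeneity of the derivatives, the factor -1 their parity. *)
Lemma partial_scale F (r : R) a x : smooth U0 F -> r != 0 -> x != 0 ->
  partial a (fun y => F (r *: y)) x = r * partial a F (r *: x).
Proof.
move=> sF r0 x0.
have rowE (y : V) : \row_b (r * y 0 b) = r *: y by apply/rowP => b; rewrite !mxE.
have Cs (b : 'I_n) : Ck 1 U0 (fun y : V => r * y 0 b).
  apply: CkM; [exact: open_punctured|exact: Ck_cst|].
  by apply: Ck_coord; exact: open_punctured.
have rx0 : U0 (\row_b (r * x 0 b)) by rewrite rowE /=; exact: scale_neq0.
have [_] := partial_comp open_punctured open_punctured a Cs (sF 1%N) x0 rx0.
rewrite rowE; under eq_fun do rewrite rowE.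
move=> ->; rewrite (bigD1 a) //= big1 ?addr0; last first.
  move=> b ba; rewrite /partial deriveMl; last exact: derivable_coord_row.
  by rewrite -/(partial a _ x) partial_coord eq_sym (negbTE ba) !mulr0.
rewrite {2}/partial deriveMl; last exact: derivable_coord_row.
by rewrite -/(partial a _ x) partial_coord eqxx mulr1 mulrC.
Qed.

(** An arbitrary multiplier [c] replaces an exponent, so that degree -1 is [r^-1] and
    differentiation just divides by [r]. Only positive [r] occur; behaviour under [x -> - x] is a
    separate hypothesis wherever it is used. *)
Definition homogeneous (c : R -> R) F : Prop :=
  forall r x, 0 < r -> x != 0 -> F (r *: x) = c r * F x.

Lemma homogeneous_partial c F a : smooth U0 F -> homogeneous c F ->
  homogeneous (fun r => c r / r) (partial a F).
Proof.
move=> sF hF r x r0 x0; have rn0 := lt0r_neq0 r0.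
apply: (mulfI rn0); rewrite -partial_scale //.
rewrite (partial_eq_on open_punctured (h' := fun y => c r * F y) a _ x0); last first.
  by move=> y; rewrite inE => y0; exact: hF.
have dF : derivable F x (e a) := Ck_derivable (sF 1%N) x0.
rewrite /partial deriveMl //; field; exact: rn0.
Qed.

(** The derivative along [x] is that of [s -> F ((1 + s) x) = c (1 + s) F x] at 0, so the degree
    enters as [d = c'(1)]. *)
Lemma Euler c (d : R) F x : smooth U0 F -> homogeneous c F ->
  is_derive (0 : R) (1 : R) (fun s => c (1 + s)) d -> x != 0 ->
  \sum_a x 0 a * partial a F x = d * F x.
Proof.
move=> sF hF [dc dE] x0.
have [dF FE] := C1_differentiable open_punctured (sF 1%N) x0.
have : derivable F (x + (0 : R) *: x) x.
  by rewrite scale0r addr0; exact: diff_derivable.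
move=> /is_derive_line; rewrite scale0r addr0 => -[_ E].
rewrite -FE -deriveE // -E.
transitivity ('D_1 (fun s : R => c (1 + s) * F x) (0 : R)).
  apply: near_eq_derive; near=> s.
  rewrite -[in LHS](scale1r x) scalerA mulr1 -scalerDl hF //.
  rewrite -ltrBlDl sub0r; near: s; apply: lt_nbhsr; lra.
by rewrite deriveMr // dE mulrC.
Unshelve. all: by end_near. Qed.

Lemma zero_gradient_segment F x w : smooth U0 F ->
  (forall a y, y != 0 -> partial a F y = 0) ->
  (forall t : R, x + t *: w != 0) -> F (x + w) = F x.
Proof.
move=> sF F0 xw.
have dF t := C1_differentiable open_punctured (sF 1%N) (xw t).
have [t _] : exists2 t : R, `|t| <= `|1| &
    F (x + 1 *: w) - F x = 1 * 'D_w F (x + t *: w).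
  by apply: MVT_line => t _; apply: diff_derivable; have [] := dF t.
have [dFt FE] := dF t; rewrite deriveE // FE big1; last first.
  by move=> a _; rewrite F0 ?mulr0.
by rewrite mulr0 scale1r => /subr0_eq.
Qed.

Lemma zero_gradient_odd F : (2 <= n)%N -> smooth U0 F ->
  (forall a y, y != 0 -> partial a F y = 0) ->
  (forall x, x != 0 -> F (- x) = - F x) -> forall x, x != 0 -> F x = 0.
Proof.
move=> n2 sF F0 Fodd x x0.
have [a xa] : exists a, x 0 a != 0.
  apply/existsP; apply: contraNT x0 => /existsPn x0.
  by apply/eqP/rowP => a; rewrite mxE; apply/eqP; rewrite -[_ == _]negbK x0.
have [b ba] : exists b : 'I_n, b != a.
  pose b0 := Ordinal (ltnW n2); pose b1 := Ordinal n2.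
  by have [<-|] := eqVneq b0 a; [exists b1|exists b0].
(* The segment from [x] to [- x] meets the origin. The detour goes through [w], the quarter turn of
   [x] in the [a], [b] plane: the lines from [x] and from [- x] to [w] avoid 0, whence
   [F x = F w = F (- x)]. *)
pose w : V := x 0 a *: e b - x 0 b *: e a.
have wa : w 0 a = - x 0 b.
  by rewrite !mxE eqxx /= eq_sym (negbTE ba) eqxx mulr0 mulr1 sub0r.
have wb : w 0 b = x 0 a.
  by rewrite !mxE eqxx /= (negbTE ba) eqxx mulr0 mulr1 subr0.
have indep (s t : R) : (s != 0) || (t != 0) -> s *: x + t *: w != 0.
  move=> st; apply/eqP => /rowP E; have Ea := E a; have Eb := E b; move: Ea Eb.
  rewrite [(s *: x + _) 0 a]mxE [(s *: x) 0 a]mxE [(t *: w) 0 a]mxE wa.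
  rewrite [(s *: x + _) 0 b]mxE [(s *: x) 0 b]mxE [(t *: w) 0 b]mxE wb !mxE.
  move=> Ea Eb.
  have q0 : x 0 a ^+ 2 + x 0 b ^+ 2 != 0.
    by rewrite gt_eqF // ltr_pwDl ?sqr_ge0 // lt0r sqrf_eq0 xa sqr_ge0.
  have s0 : s = 0.
    apply: (mulIf q0); rewrite mul0r.
    transitivity ((s * x 0 a + t * - x 0 b) * x 0 a + (s * x 0 b + t * x 0 a) * x 0 b).
      by ring.
    by rewrite Ea Eb !mul0r addr0.
  have t0 : t = 0.
    apply: (mulIf q0); rewrite mul0r.
    transitivity ((s * x 0 a + t * - x 0 b) * - x 0 b + (s * x 0 b + t * x 0 a) * x 0 a).
      by ring.
    by rewrite Ea Eb !mul0r addr0.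
  by rewrite s0 t0 eqxx in st.
have E1 : F w = F x.
  rewrite -[w](addrNK x) addrC.
  apply: zero_gradient_segment => // t.
  have -> : x + t *: (w - x) = (1 - t) *: x + t *: w.
    by rewrite scalerBr scalerBl scale1r addrCA addrC.
  by apply: indep; have [->|t0] := eqVneq t 0; rewrite ?subr0 ?oner_eq0 ?orbT.
have E2 : F w = F (- x).
  rewrite -[w](addrK x) addrC; apply: zero_gradient_segment => // t.
  have -> : - x + t *: (w + x) = (t - 1) *: x + t *: w.
    by rewrite scalerDr scalerBl scale1r [_ - x]addrC addrCA addrC.
  apply: indep; have [->|t0] := eqVneq t 0; last by rewrite orbT.
  by rewrite sub0r oppr_eq0 oner_eq0.
have := Fodd x x0; rewrite -E2 E1; lra.
Qed.

End Punctured.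

(** * Harmonic homogeneous functions of the wrong parity *)

Section Harmonic.
Context {R : realType} {n : nat}.
Local Notation V := 'rV[R]_n.
Local Notation e a := (delta_mx 0 a : V).
Local Notation U0 := [set x : V | x != 0].
Implicit Types (F G : V -> R) (x : V).

Definition sqnorm x : R := \sum_a x 0 a ^+ 2.

Lemma sqnorm_ge0 x : 0 <= sqnorm x.
Proof. by apply: sumr_ge0 => a _; exact: sqr_ge0. Qed.

Lemma sqnorm_eq0 x : (sqnorm x == 0) = (x == 0).
Proof.
apply/idP/eqP => [|->]; last first.
  by rewrite /sqnorm big1 // => a _; rewrite mxE expr0n.
rewrite psumr_eq0 => [|a _]; last exact: sqr_ge0.
move=> /allP x0; apply/rowP => a; rewrite mxE; apply/eqP.
by have := x0 a (mem_index_enum _); rewrite sqrf_eq0.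
Qed.

Lemma sqnorm_gt0 x : (0 < sqnorm x) = (x != 0).
Proof. by rewrite lt_neqAle sqnorm_ge0 andbT eq_sym sqnorm_eq0. Qed.

Lemma sqnormZ (r : R) x : sqnorm (r *: x) = r ^+ 2 * sqnorm x.
Proof.
by rewrite /sqnorm mulr_sumr; apply: eq_bigr => a _; rewrite mxE exprMn.
Qed.

Lemma smooth_coord U a : open U -> smooth U (fun x : V => x 0 a).
Proof. by move=> oU k; exact: Ck_coord. Qed.

Lemma smooth_sqnorm U : open U -> smooth U sqnorm.
Proof.
by move=> oU k; apply: Ck_sum => // a; apply: CkX => //; exact: smooth_coord.
Qed.

Lemma smoothM U F G : open U -> smooth U F -> smooth U G ->
  smooth U (fun x => F x * G x).
Proof. by move=> oU sF sG k; exact: CkM. Qed.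

Lemma partial_sqnorm a x : partial a sqnorm x = 2 * x 0 a.
Proof.
have sc b : smooth setT (fun x : V => x 0 b) by exact: smooth_coord openT.
rewrite /sqnorm (partial_sum _ _ openT (x := x)) => [|b|//]; last first.
  by move=> k; apply: CkX; [exact: openT|exact: sc].
rewrite (bigD1 a) //= big1 ?addr0 => [|b ba].
  under eq_fun do rewrite expr2.
  by rewrite (partialM _ (sc a) (sc a)) // partial_coord eqxx /=; ring.
under eq_fun do rewrite expr2.
by rewrite (partialM _ (sc b) (sc b)) // partial_coord eq_sym (negbTE ba) /=; ring.
Qed.

Definition harmonic F : Prop := forall x, x != 0 -> laplacian F x = 0.

Lemma harmonic_partial F a : smooth U0 F -> harmonic F -> harmonic (partial a F).
Proof.
move=> sF hF x x0.
transitivity (\sum_b partial a (partial b (partial b F)) x).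
  apply: eq_bigr => b _.
  apply: etrans _ (partialC b a open_punctured (smooth_partial b sF 2%N) x0).
  apply: (partial_eq_on open_punctured) x0 => y; rewrite inE => y0.
  exact: partialC b a open_punctured (sF 2%N) y0.
rewrite -(partial_sum _ _ open_punctured) //; last first.
  by move=> b; do 2 apply: smooth_partial.
rewrite (partial_eq_on open_punctured (h' := fun=> 0)) //.
  exact: derive_cst.
by move=> y; rewrite inE => y0; exact: hF.
Qed.

Lemma odd_partial F (s : R) a : smooth U0 F ->
  (forall x, x != 0 -> F (- x) = s * F x) ->
  forall x, x != 0 -> partial a F (- x) = - s * partial a F x.
Proof.
move=> sF Fs x x0.
have N1 : (-1 : R) != 0 by rewrite oppr_eq0 oner_eq0.
have := partial_scale a sF N1 x0.
rewrite (partial_eq_on open_punctured (h' := fun y => s * F y)) //; last first.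
  by move=> y; rewrite inE scaleN1r => y0; exact: Fs.
have dF : derivable F x (e a) := Ck_derivable (sF 1%N) x0.
by rewrite scaleN1r {1}/partial deriveMl // -/(partial a F x) mulN1r => E; rewrite mulNr E opprK.
Qed.

(** A function of degree 0 is determined by its values on the unit sphere of any norm; the maximum
    norm of row vectors serves, its unit sphere being compact. *)
Lemma homogeneous0_max G : (0 < n)%N -> smooth U0 G -> homogeneous (fun=> 1) G ->
  exists2 y, y != 0 & forall x, x != 0 -> G x <= G y.
Proof.
move=> n0 sG hG.
pose A : set V := [set x | `|x| = 1].
have A0 x : A x -> x != 0 by move=> Ax; rewrite -normr_eq0 Ax oner_eq0.
have cA : compact A.
  apply: bounded_closed_compact.
    exists 1; split; first exact: num_real.
    by move=> M M1 x; rewrite /A /= => ->; exact: ltW.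
  rewrite (_ : A = Num.norm @^-1` [set (1 : R)]) //.
  apply: (continuous_closedP _).1; first exact: norm_continuous.
  exact: closed_eq.
have Anorm x : x != 0 -> A (`|x|^-1 *: x).
  move=> x0; rewrite /A /= normrZ normfV normr_id mulVf //.
  by rewrite normr_eq0.
have e0 : e (Ordinal n0) != 0.
  apply/eqP => /rowP /(_ (Ordinal n0)); rewrite !mxE !eqxx /=.
  by apply/eqP; rewrite oner_eq0.
have An : A !=set0 by exists (`|e (Ordinal n0)|^-1 *: e (Ordinal n0)); exact: Anorm.
have cG : {within A, continuous G}.
  apply: continuous_in_subspaceT => x; rewrite inE => /A0 x0.
  exact: (Ck_continuous (sG 0%N)).
have [y] := EVT_max_rV An cA cG; rewrite inE => /A0 y0 ymax.
exists y => // x x0; have := ymax _ (mem_set (Anorm x x0)).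
by rewrite hG ?mul1r // invr_gt0 normr_gt0.
Qed.

Lemma is_derive_onep : is_derive (0 : R) (1 : R) (fun s : R => 1 + s) 1.
Proof.
have := is_deriveD (is_derive_cst (1 : R) (0 : R) (1 : R)) (is_derive_id (0 : R) (1 : R)).
by rewrite add0r.
Qed.

Lemma is_derive_onepV : is_derive (0 : R) (1 : R) (fun s : R => (1 + s)^-1) (- 1).
Proof.
have [d E] := is_derive_onep.
have n0 : 1 + 0 != 0 :> R by rewrite addr0 oner_neq0.
apply: DeriveDef; first exact: derivableV n0 d.
by rewrite (deriveV n0 d) E addr0 expr1n invr1 scaleN1r.
Qed.

Lemma is_derive_onepX i :
  is_derive (0 : R) (1 : R) (fun s : R => (1 + s) ^+ i) i%:R.
Proof.
have := is_deriveX i is_derive_onep.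
by rewrite exprfctE addr0 expr1n mulr1 -[_ *: _]/(_ * _) mulr1.
Qed.

(* At a maximum point [y] of the degree 0 function [|x|^2 G(x)^2] its Laplacian
   [(2 n - 8) G^2 + 2 |x|^2 |grad G|^2] is nonpositive, so [grad G] vanishes at
   [y], and so does [G y] by Euler's identity. *)
Lemma homogeneousN1_harmonic_eq0 G : (4 <= n)%N -> smooth U0 G ->
  homogeneous (fun r => r^-1) G -> harmonic G -> forall x, x != 0 -> G x = 0.
Proof.
move=> n4 sG hG lG.
have o0 := @open_punctured R n.
have sS := smooth_sqnorm o0.
have sD a := smooth_partial a sG.
have sc a := smooth_coord a o0.
have EulerG x : x != 0 -> \sum_a x 0 a * partial a G x = - G x.
  by move=> x0; rewrite (Euler sG hG is_derive_onepV) // mulN1r.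
pose H x := sqnorm x * (G x * G x).
have sGG : smooth U0 (fun x => G x * G x) by exact: smoothM.
have sH : smooth U0 H by exact: smoothM.
have hH : homogeneous (fun=> 1) H.
  by move=> r x r0 x0; rewrite /H sqnormZ hG //; field; exact: lt0r_neq0.
have [|y y0 ymax] := homogeneous0_max _ sH hH; first exact: leq_trans n4.
have sGD a : smooth U0 (fun x => G x * partial a G x) by exact: smoothM.
have sSGD a : smooth U0 (fun x => sqnorm x * (G x * partial a G x)) by exact: smoothM.
have scGG a : smooth U0 (fun x => x 0 a * (G x * G x)) by exact: smoothM.
have D1 a x : x != 0 -> partial a H x =
    (sqnorm x * (G x * partial a G x) + x 0 a * (G x * G x)) +
    (sqnorm x * (G x * partial a G x) + x 0 a * (G x * G x)).
  move=> x0; rewrite (partialM a sS sGG x0) (partialM a sG sG x0) partial_sqnorm.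
  ring.
have sP a : smooth U0 (fun x => sqnorm x * (G x * partial a G x) + x 0 a * (G x * G x)).
  by move=> k; apply: CkD => //; [exact: sSGD|exact: scGG].
have D2 a : partial a (partial a H) y = 2 * (G y * G y)
    + 8 * (G y * (y 0 a * partial a G y))
    + 2 * sqnorm y * partial a G y ^+ 2
    + 2 * sqnorm y * G y * partial a (partial a G) y.
  rewrite (partial_eq_on o0 (h' := fun x =>
    (sqnorm x * (G x * partial a G x) + x 0 a * (G x * G x)) +
    (sqnorm x * (G x * partial a G x) + x 0 a * (G x * G x)))) //; last first.
    by move=> x; rewrite inE => x0; exact: D1.
  rewrite (partialD a (sP a) (sP a) y0) (partialD a (sSGD a) (scGG a) y0).
  rewrite (partialM a sS (sGD a) y0) (partialM a sG (sD a) y0).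
  rewrite (partialM a (sc a) sGG y0) (partialM a sG sG y0).
  rewrite partial_sqnorm partial_coord eqxx /=; ring.
have lapH : laplacian H y <= 0.
  by apply: sumr_le0 => a _; exact: second_partial_at_max o0 (sH 2%N) y0 ymax.
have lapHE : laplacian H y = (2 * n%:R - 8) * G y ^+ 2 +
    2 * sqnorm y * \sum_a partial a G y ^+ 2.
  rewrite /laplacian (eq_bigr _ (fun a _ => D2 a)) !big_split /= -!mulr_sumr.
  rewrite sumr_const card_ord EulerG // -/(laplacian G y) lG // -[_ *+ n]mulr_natr.
  ring.
have grad0 : \sum_a partial a G y ^+ 2 <= 0.
  have n4' : 4 <= n%:R :> R by rewrite (ler_nat R 4 n).
  have Sy : 0 < 2 * sqnorm y by rewrite mulr_gt0 // sqnorm_gt0.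
  have G2 : 0 <= (2 * n%:R - 8) * G y ^+ 2.
    by rewrite mulr_ge0 ?sqr_ge0 //; move: n4'; lra.
  by rewrite -(pmulr_rle0 _ Sy); move: lapH G2; rewrite lapHE; lra.
have Gy : G y = 0.
  apply/eqP; rewrite -oppr_eq0 -EulerG // big1 // => a _.
  have : partial a G y ^+ 2 == 0.
    rewrite eq_le sqr_ge0 andbT (le_trans _ grad0) // (bigD1 a) //= lerDl.
    by apply: sumr_ge0 => b _; exact: sqr_ge0.
  by rewrite sqrf_eq0 => /eqP ->; rewrite mulr0.
(* The maximum of [H] is now 0, while [H] is nonnegative everywhere. *)
move=> x x0; have := ymax x x0; rewrite /H Gy mulr0 mulr0 => Hx.
have : sqnorm x * (G x * G x) == 0.
  by rewrite eq_le Hx mulr_ge0 ?sqnorm_ge0 // -expr2 sqr_ge0.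
by rewrite mulf_eq0 sqnorm_eq0 (negbTE x0) /= -expr2 sqrf_eq0 => /eqP.
Qed.

(** The rotational derivative [T] has zero gradient: harmonicity and the symmetry of second
    derivatives turn each component into Euler's identity for a first derivative of [F], of degree
    -1. Once [T = 0], the radial and rotational derivatives both vanish, and they determine the
    gradient because their determinant is [|x|^2]. *)
Lemma homogeneous0_harmonic_plane F : n = 2%N -> smooth U0 F ->
  homogeneous (fun=> 1) F -> harmonic F ->
  (forall x, x != 0 -> F (- x) = - F x) ->
  forall c x, x != 0 -> partial c F x = 0.
Proof.
move=> n2 sF hF lF Fodd.
have o0 := @open_punctured R n.
have lt0n2 : (0 < n)%N by rewrite n2.
have lt1n2 : (1 < n)%N by rewrite n2.
pose a : 'I_n := Ordinal lt0n2; pose b : 'I_n := Ordinal lt1n2.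
have abP c : c = a \/ c = b.
  have : (c < 2)%N by rewrite -[X in (_ < X)%N]n2.
  by case: c => -[|[|c]] ltc //= _; [left|right]; apply: val_inj.
have sum2 (f : 'I_n -> R) : \sum_c f c = f a + f b.
  rewrite (bigD1 a) //= (bigD1 b) //= big1 ?addr0 // => c /andP[ca cb].
  by have [cE|cE] := abP c; rewrite cE eqxx in ca cb.
have sG c := smooth_partial c sF.
have sc c := smooth_coord c o0.
have sM c d : smooth U0 (fun x => x 0 c * partial d F x) by exact: smoothM.
have hG c : homogeneous (fun r => r^-1) (partial c F).
  by move=> r x r0 x0; rewrite (homogeneous_partial c sF hF) // div1r.
have EG c x : x != 0 ->
    x 0 a * partial a (partial c F) x + x 0 b * partial b (partial c F) x =
    - partial c F x.
  by move=> x0; rewrite -(sum2 (fun d => x 0 d * partial d (partial c F) x)) (Euler (sG c) (hG c) is_derive_onepV) // mulN1r.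
have EF x : x != 0 -> x 0 a * partial a F x + x 0 b * partial b F x = 0.
  have dc : is_derive (0 : R) (1 : R) (fun=> 1 : R) 0 by exact: is_derive_cst.
  by move=> x0; rewrite -(sum2 (fun d => x 0 d * partial d F x)) (Euler sF hF dc) // mul0r.
have lE x : x != 0 ->
    partial b (partial b F) x = - partial a (partial a F) x.
  by move=> /lF; rewrite /laplacian sum2 => /eqP; rewrite addrC addr_eq0 => /eqP.
have sym x : x != 0 -> partial b (partial a F) x = partial a (partial b F) x.
  by move=> x0; exact: partialC o0 (sF 2%N) x0.
pose T x := x 0 a * partial b F x - x 0 b * partial a F x.
have sT : smooth U0 T by move=> k; apply: CkB => //; [exact: sM|exact: sM].
have T0 x : x != 0 -> T x = 0.
  move: x; apply: (zero_gradient_odd lt1n2 sT) => [c x x0|x x0].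
    rewrite /T (partialB c (sM a b) (sM b a) x0).
    rewrite (partialM c (sc a) (sG b) x0) (partialM c (sc b) (sG a) x0).
    have := EG a x x0; have := EG b x x0; rewrite lE // sym //.
    have pE d d' (k : R) : (d == d')%:R = k -> partial d (fun v : V => v 0 d') x = k.
      by move=> <-; exact: partial_coord.
    case: (abP c) => ->.
      rewrite (pE a a 1) ?eqxx // (pE a b 0) //.
      move: (partial a (partial a F) x) (partial a (partial b F) x).
      by move: (partial a F x) (partial b F x) (x 0 a) (x 0 b) => *; lra.
    rewrite (pE b b 1) ?eqxx // (pE b a 0) // lE // sym //.
    move: (partial a (partial a F) x) (partial a (partial b F) x).
    by move: (partial a F x) (partial b F x) (x 0 a) (x 0 b) => *; lra.
  rewrite /T !mxE.
  have Fs y : y != 0 -> F (- y) = - 1 * F y by move=> y0; rewrite mulN1r Fodd.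
  by rewrite !(odd_partial _ sF Fs) //; ring.
have key x : x != 0 -> partial a F x = 0 /\ partial b F x = 0.
  move=> x0; have := T0 x x0; have := EF x x0; rewrite /T => E1 E2.
  have S0 : x 0 a ^+ 2 + x 0 b ^+ 2 != 0.
    by rewrite -(sum2 (fun c => x 0 c ^+ 2)) -/(sqnorm x) sqnorm_eq0.
  split; apply: (mulfI S0); rewrite mulr0.
    transitivity (x 0 a * (x 0 a * partial a F x + x 0 b * partial b F x)
      - x 0 b * (x 0 a * partial b F x - x 0 b * partial a F x)); first by ring.
    by rewrite E1 E2 !mulr0 subr0.
  transitivity (x 0 b * (x 0 a * partial a F x + x 0 b * partial b F x)
    + x 0 a * (x 0 a * partial b F x - x 0 b * partial a F x)); first by ring.
  by rewrite E1 E2 !mulr0 addr0.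
by move=> c x /key [ga gb]; have [->|->] := abP c.
Qed.

Lemma homogeneous0_harmonic_odd_eq0 F : n = 2%N \/ (4 <= n)%N ->
  smooth U0 F -> homogeneous (fun=> 1) F -> harmonic F ->
  (forall x, x != 0 -> F (- x) = - F x) -> forall x, x != 0 -> F x = 0.
Proof.
move=> n24 sF hF lF Fodd; apply: zero_gradient_odd => //.
  by case: n24 => [->//|]; exact: leq_trans.
case: n24 => [n2|n4] c; first exact: homogeneous0_harmonic_plane.
have hG : homogeneous (fun r => r^-1) (partial c F).
  by move=> r x r0 x0; rewrite (homogeneous_partial c sF hF) // div1r.
exact: homogeneousN1_harmonic_eq0 n4 (smooth_partial c sF) hG
  (harmonic_partial c sF lF).
Qed.

(* Each derivative lowers the degree by one and flips the parity, until degree 0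
   is reached; Euler's identity climbs back. *)
Lemma harmonic_wrong_parity_eq0 (i : nat) F : n = 2%N \/ (4 <= n)%N ->
  smooth U0 F -> homogeneous (fun r => r ^+ i) F -> harmonic F ->
  (forall x, x != 0 -> F (- x) = (- 1) ^+ i.+1 * F x) ->
  forall x, x != 0 -> F x = 0.
Proof.
move=> n24; elim: i F => [|i IH] F sF hF lF Fp x x0.
  apply: homogeneous0_harmonic_odd_eq0 => // y y0.
  by rewrite Fp // expr1 mulN1r.
have := Euler sF hF (is_derive_onepX i.+1) x0; rewrite big1 => [/esym/eqP|a _].
  by rewrite mulf_eq0 pnatr_eq0 /= => /eqP.
have hG : homogeneous (fun r => r ^+ i) (partial a F).
  move=> r y r0 y0; rewrite (homogeneous_partial a sF hF) // exprSr mulfK //.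
  exact: lt0r_neq0.
have Gp y : y != 0 -> partial a F (- y) = (-1) ^+ i.+1 * partial a F y.
  by move=> y0; rewrite (odd_partial a sF Fp) // [in LHS]exprS mulN1r opprK.
by rewrite (IH _ (smooth_partial a sF) hG (harmonic_partial a sF lF) Gp x x0) mulr0.
Qed.

End Harmonic.

(** * Stereographic charts *)

Section Stereographic.
Context {R : realType} {n N : nat}.
Local Notation V := 'rV[R]_n.
Local Notation X := 'rV[R]_N.

(** An orthonormal basis whose vector of index 0 is the centre of the chart. Both orthogonality
    relations are fields because the two index types will be ['I_(2 * m).-1.+1] and ['I_(m + m)],
    whose sizes agree only up to a proof. *)
Record orthoframe := OrthoFrame {
  frame :> 'I_n.+1 -> X;
  frame_dot : forall k l, \sum_c frame k 0 c * frame l 0 c = (k == l)%:R;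
  frame_complete : forall c d, \sum_k frame k 0 c * frame k 0 d = (c == d)%:R }.

Variable f : orthoframe.

Local Notation pole := (f ord0).
Local Notation tan a := (f (lift ord0 a)).

Definition tangent_sum (u : V) (c : 'I_N) : R := \sum_a u 0 a * tan a 0 c.

(** The conformal factor: the round metric in this chart is [stereo_scale u ^+ 2] times the
    identity. *)
Definition stereo_scale (u : V) : R := 2 / (1 + sqnorm u).

(* The inverse of the stereographic projection from [- pole]; note that
   [(1 - |u|^2) / (1 + |u|^2)] is [stereo_scale u - 1]. *)
Definition stereo_coord (c : 'I_N) (u : V) : R :=
  (stereo_scale u - 1) * pole 0 c + stereo_scale u * tangent_sum u c.

Definition stereo (u : V) : X := \row_c stereo_coord c u.

Lemma sqnormD1_gt0 (u : V) : 0 < 1 + sqnorm u.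
Proof. by rewrite ltr_pwDl ?sqnorm_ge0. Qed.

Lemma stereo_scale_gt0 u : 0 < stereo_scale u.
Proof. by rewrite divr_gt0 // sqnormD1_gt0. Qed.

Lemma stereo_scaleE u : stereo_scale u * (1 + sqnorm u) = 2.
Proof. by rewrite divfK // gt_eqF // sqnormD1_gt0. Qed.

Lemma tangent_sum_pole u : \sum_c tangent_sum u c * pole 0 c = 0.
Proof.
under eq_bigr do rewrite mulr_suml; rewrite exchange_big big1 // => a _.
under eq_bigr do rewrite -mulrA; rewrite -mulr_sumr frame_dot.
by rewrite mulr0.
Qed.

Lemma tangent_sum_tangent u a : \sum_c tangent_sum u c * tan a 0 c = u 0 a.
Proof.
under eq_bigr do rewrite mulr_suml; rewrite exchange_big (bigD1 a) //=.
under eq_bigr do rewrite -mulrA; rewrite -mulr_sumr frame_dot eqxx mulr1.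
rewrite big1 ?addr0 // => b ba.
under eq_bigr do rewrite -mulrA; rewrite -mulr_sumr frame_dot.
by rewrite (inj_eq (lift_inj (h := ord0))) (negbTE ba) mulr0.
Qed.

Lemma tangent_sum_norm u : \sum_c tangent_sum u c * tangent_sum u c = sqnorm u.
Proof.
under eq_bigr do rewrite {2}/tangent_sum mulr_sumr.
rewrite exchange_big; apply: eq_bigr => a _ /=.
under eq_bigr do rewrite mulrCA; rewrite -mulr_sumr tangent_sum_tangent.
by rewrite expr2.
Qed.

Lemma pole_dot : \sum_c pole 0 c * pole 0 c = 1.
Proof. by rewrite frame_dot. Qed.

Lemma tangent_dot a b : \sum_c tan a 0 c * tan b 0 c = (a == b)%:R.
Proof. by rewrite frame_dot (inj_eq (lift_inj (h := ord0))). Qed.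

Lemma pole_tangent_dot a : \sum_c pole 0 c * tan a 0 c = 0.
Proof. by rewrite frame_dot. Qed.

(** First derivatives of the chart are combinations of this shape, so this computes the metric
    coefficients. *)
Lemma frame_combination_dot u a b (p t s p' t' s' : R) :
  \sum_c (p * pole 0 c + t * tangent_sum u c + s * tan a 0 c) *
         (p' * pole 0 c + t' * tangent_sum u c + s' * tan b 0 c) =
  p * p' + t * t' * sqnorm u + t * s' * u 0 b + s * t' * u 0 a
  + s * s' * (a == b)%:R.
Proof.
transitivity (\sum_c (p * p' * (pole 0 c * pole 0 c)
  + (p * t' + t * p') * (tangent_sum u c * pole 0 c)
  + t * t' * (tangent_sum u c * tangent_sum u c)
  + p * s' * (pole 0 c * tan b 0 c) + s * p' * (pole 0 c * tan a 0 c)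
  + t * s' * (tangent_sum u c * tan b 0 c)
  + s * t' * (tangent_sum u c * tan a 0 c)
  + s * s' * (tan a 0 c * tan b 0 c))).
  by apply: eq_bigr => c _; ring.
rewrite !big_split /= -!mulr_sumr pole_dot tangent_sum_pole tangent_sum_norm.
rewrite !pole_tangent_dot !tangent_sum_tangent tangent_dot; ring.
Qed.

Lemma sqnorm_stereo u : sqnorm (stereo u) = 1.
Proof.
have sE := stereo_scaleE u.
transitivity (\sum_c ((stereo_scale u - 1) ^+ 2 * (pole 0 c * pole 0 c)
  + 2 * (stereo_scale u - 1) * stereo_scale u * (tangent_sum u c * pole 0 c)
  + stereo_scale u ^+ 2 * (tangent_sum u c * tangent_sum u c))).
  by apply: eq_bigr => c _; rewrite mxE /stereo_coord; ring.
rewrite !big_split /= -!mulr_sumr pole_dot tangent_sum_pole tangent_sum_norm.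
transitivity (1 + stereo_scale u * (stereo_scale u * (1 + sqnorm u) - 2)).
  by ring.
by rewrite sE subrr mulr0 addr0.
Qed.

Lemma stereo0 : stereo 0 = pole.
Proof.
apply/rowP => c; rewrite mxE /stereo_coord /stereo_scale /tangent_sum.
rewrite big1 => [|a _]; last by rewrite mxE mul0r.
have /eqP -> : sqnorm (0 : V) == 0 by rewrite sqnorm_eq0.
by rewrite addr0 divr1 mulr0 addr0 -[2]/(1 + 1) addrK mul1r.
Qed.

Lemma smooth_cst U (c : R) : smooth U (fun _ : V => c).
Proof. by move=> k; exact: Ck_cst. Qed.

Lemma smooth_stereo_scale : smooth setT stereo_scale.
Proof.
move=> k; apply: CkM; [exact: openT|exact: Ck_cst|].
apply: CkV => [|u _|]; [exact: openT|by rewrite gt_eqF // sqnormD1_gt0|].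
by apply: CkD; [exact: openT|exact: Ck_cst|exact: smooth_sqnorm openT _].
Qed.

Lemma smooth_tangent_sum c : smooth setT (tangent_sum ^~ c).
Proof.
move=> k; apply: (Ck_sum openT) => a; apply: (CkM openT).
  exact: smooth_coord openT k.
exact: Ck_cst.
Qed.

Lemma smooth_stereo_coord c : smooth setT (stereo_coord c).
Proof.
move=> k; apply: (CkD openT); apply: (CkM openT).
- by apply: (CkB openT); [exact: smooth_stereo_scale|exact: Ck_cst].
- exact: Ck_cst.
- exact: smooth_stereo_scale.
exact: smooth_tangent_sum.
Qed.

Lemma partial_stereo_scale a u :
  partial a stereo_scale u = - stereo_scale u ^+ 2 * u 0 a.
Proof.
have Q0 : 1 + sqnorm u != 0 by rewrite gt_eqF // sqnormD1_gt0.
have sQ : smooth setT (fun v : V => 1 + sqnorm v).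
  by move=> k; apply: (CkD openT); [exact: Ck_cst|exact: smooth_sqnorm openT _].
have dQ : derivable (fun v : V => 1 + sqnorm v) u (delta_mx 0 a) :=
  Ck_derivable (sQ 1%N) I.
have pQ : partial a (fun v : V => 1 + sqnorm v) u = 2 * u 0 a.
  rewrite (partialD a (smooth_cst _ 1) (smooth_sqnorm openT)) //.
  by rewrite partial_sqnorm [X in X + _]derive_cst add0r.
have sV : smooth setT (fun v : V => (1 + sqnorm v)^-1).
  by move=> k; apply: (CkV openT) => // v _; rewrite gt_eqF // sqnormD1_gt0.
have pV : partial a (fun v : V => (1 + sqnorm v)^-1) u =
    - (1 + sqnorm u) ^- 2 * (2 * u 0 a).
  have E := @deriveV R V (fun v : V => 1 + sqnorm v) u (delta_mx 0 a) Q0 dQ.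
  by apply: etrans E _; rewrite -[_ *: _]/(_ * _) -/(partial a _ u) pQ.
rewrite -[stereo_scale in LHS]/(fun v : V => 2 * (1 + sqnorm v)^-1).
rewrite (partialM a (smooth_cst _ 2) sV) // pV [partial a (fun=> 2) u]derive_cst.
by rewrite /stereo_scale; field.
Qed.

Lemma partial_tangent_sum a c u : partial a (tangent_sum ^~ c) u = tan a 0 c.
Proof.
have sc b : smooth setT (fun x : V => x 0 b) := smooth_coord b openT.
have pM b : partial a (fun u : V => u 0 b * tan b 0 c) u = tan b 0 c * (a == b)%:R.
  rewrite (partialM a (sc b) (smooth_cst _ _)) // partial_coord.
  by rewrite [partial _ _ _]derive_cst mulr0 add0r.
rewrite /tangent_sum (partial_sum _ _ openT) //; last first.
  by move=> b; exact: smoothM openT (sc b) (smooth_cst _ _).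
rewrite (eq_bigr _ (fun b _ => pM b)) (bigD1 a) //= eqxx mulr1 big1 ?addr0 //.
by move=> b ba; rewrite eq_sym (negbTE ba) mulr0.
Qed.

Lemma partial_stereo a c u : partial a (stereo_coord c) u =
  - stereo_scale u ^+ 2 * u 0 a * pole 0 c
  + - stereo_scale u ^+ 2 * u 0 a * tangent_sum u c
  + stereo_scale u * tan a 0 c.
Proof.
have c1 := smooth_cst setT 1.
have cp := smooth_cst setT (pole 0 c).
have sB : smooth setT (fun u => stereo_scale u - 1).
  by move=> k; apply: (CkB openT) => //; exact: smooth_stereo_scale.
have sBp := smoothM openT sB cp.
have sS := smoothM openT smooth_stereo_scale (smooth_tangent_sum c).
rewrite (partialD a sBp sS) // (partialM a sB cp) //.
rewrite (partialM a smooth_stereo_scale (smooth_tangent_sum c)) //.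
rewrite (partialB a smooth_stereo_scale c1) //.
rewrite [partial a (fun=> pole 0 c) u]derive_cst [partial a (fun=> 1) u]derive_cst.
rewrite partial_tangent_sum partial_stereo_scale; ring.
Qed.

Lemma stereo_metric a b u :
  \sum_c partial a (stereo_coord c) u * partial b (stereo_coord c) u =
  stereo_scale u ^+ 2 * (a == b)%:R.
Proof.
under eq_bigr do rewrite !partial_stereo.
rewrite frame_combination_dot; have sE := stereo_scaleE u.
move: (stereo_scale u) (sqnorm u) (u 0 a) (u 0 b) ((a == b)%:R : R) sE => s q ua ub d sE.
transitivity (s ^+ 2 * d + s ^+ 3 * ua * ub * (s * (1 + q) - 2)); first by ring.
by rewrite sE subrr mulr0 addr0.
Qed.

Lemma stereo_scale0 : stereo_scale 0 = 2.
Proof.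
have /eqP E : sqnorm (0 : V) == 0 by rewrite sqnorm_eq0.
by rewrite /stereo_scale E addr0 divr1.
Qed.

Lemma tangent_sum0 c : tangent_sum 0 c = 0.
Proof. by rewrite /tangent_sum big1 // => a _; rewrite mxE mul0r. Qed.

(** The conformal factor is critical at the centre, so the acceleration of a coordinate line there
    is purely normal: minus the squared speed 4 times the position. *)
Lemma partial2_stereo0 a c : partial a (partial a (stereo_coord c)) 0 = - 4 * pole 0 c.
Proof.
have ss := smooth_stereo_scale.
have sc : smooth setT (fun u : V => u 0 a) := smooth_coord a openT.
have st := smooth_tangent_sum c.
have cp d := smooth_cst setT d.
pose A u := stereo_scale u * stereo_scale u * u 0 a.
have sss := smoothM openT ss ss.
have sA : smooth setT A := smoothM openT sss sc.
pose B u := pole 0 c + tangent_sum u c.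
have sB : smooth setT B by move=> k; apply: (CkD openT); [exact: cp|exact: st].
have sAB := smoothM openT sA sB.
have sT := smoothM openT ss (cp (tan a 0 c)).
rewrite (_ : partial a (stereo_coord c) =
    fun u => stereo_scale u * tan a 0 c - A u * B u); last first.
  by apply/funext => u; rewrite partial_stereo /A /B; ring.
rewrite (partialB a sT sAB) // (partialM a sA sB) // (partialM a sss sc) //.
rewrite (partialM a ss (cp _)) // [partial a (fun=> tan a 0 c) _]derive_cst.
rewrite partial_coord eqxx partial_stereo_scale /A /B stereo_scale0 tangent_sum0 !mxE /=.
ring.
Qed.

End Stereographic.

(** * The homogeneous extension of a function on the sphere *)

Lemma orthoframe_exists (R : realType) (n N : nat) (y : 'rV[R]_N) :
  n.+1 = N -> sqnorm y = 1 -> exists f : @orthoframe R n N, f ord0 = y.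
Proof.
move=> nN; case: N / nN y => y y1.
(* The Householder reflection exchanging [y] and the first basis vector. *)
pose w (b : 'I_n.+1) : R := (b == ord0)%:R - y 0 b.
pose q := \sum_b w b ^+ 2.
pose h (b c : 'I_n.+1) : R := (b == c)%:R - 2 * (w b * w c / q).
have hC b c : h b c = h c b by rewrite /h eq_sym [w b * _]mulrC.
have sumd (b : 'I_n.+1) (F : 'I_n.+1 -> R) : \sum_c (b == c)%:R * F c = F b.
  rewrite (bigD1 b) //= eqxx mul1r big1 ?addr0 // => c cb.
  by rewrite eq_sym (negbTE cb) mul0r.
(* Since division by 0 yields 0, this includes [q = 0], where [y] is already the first basis vector
   and [h] is the identity. *)
have qq : 4 * q / q / q = 4 / q.
  by have [->|q0] := eqVneq q 0; [rewrite invr0 !mulr0|field].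
have hh k l : \sum_c h k c * h l c = (k == l)%:R.
  transitivity (\sum_c ((k == c)%:R * h l c - 2 * w k / q * ((l == c)%:R * w c)
    + 4 * (w k * w l) / q / q * w c ^+ 2)).
    by apply: eq_bigr => c _; rewrite /h; ring.
  rewrite !big_split /= sumrN sumd -mulr_sumr sumd -mulr_sumr -/q /h.
  rewrite [l == k]eq_sym.
  transitivity ((k == l)%:R - 4 * (w k * w l) / q + w k * w l * (4 * q / q / q)).
    by ring.
  by rewrite qq; ring.
pose f k : 'rV[R]_n.+1 := \row_c h k c.
have f_dot k l : \sum_c f k 0 c * f l 0 c = (k == l)%:R.
  by under eq_bigr do rewrite !mxE; exact: hh.
have f_complete c d : \sum_k f k 0 c * f k 0 d = (c == d)%:R.
  by under eq_bigr do rewrite !mxE (hC _ c) (hC _ d); exact: hh.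
exists (OrthoFrame f_dot f_complete); apply/rowP => c; rewrite mxE /h.
(* As [y] is a unit vector, [q = 1 - 2 y_0 + 1]. This is what makes the reflection send the first
   basis vector to [y]. *)
have qE : q = 2 * w ord0.
  transitivity (\sum_b ((ord0 == b)%:R * (1 - 2 * y 0 b) + y 0 b ^+ 2)).
    apply: eq_bigr => b _; rewrite /w eq_sym.
    by case: (ord0 == b) => /=; ring.
  by rewrite big_split /= sumd -/(sqnorm y) y1 /w eqxx /=; ring.
have [w0|w0] := eqVneq (w ord0) 0; last first.
  have -> : 2 * (w ord0 * w c / q) = w c by rewrite qE; field.
  by rewrite /w eq_sym; ring.
have /eqP : w c ^+ 2 == 0.
  rewrite eq_le sqr_ge0 andbT; apply: (@le_trans _ _ q).
    by rewrite /q (bigD1 c) //= lerDl sumr_ge0 // => b _; exact: sqr_ge0.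
  by rewrite qE w0 mulr0.
move/eqP; rewrite sqrf_eq0 => /eqP wc; rewrite wc mulr0 mul0r mulr0 subr0.
by move: wc; rewrite /w eq_sym => /subr0_eq.
Qed.

Section Extension.
Context {R : realType} {n N : nat}.
Local Notation V := 'rV[R]_n.
Local Notation X := 'rV[R]_N.
Local Notation U0 := [set x : X | x != 0].
Local Notation pole f := ((f : orthoframe) ord0).
Local Notation tan f a := ((f : orthoframe) (lift ord0 a)).

(** The Euclidean norm, as opposed to the maximum norm that row vectors carry. *)
Definition enorm (x : X) : R := Num.sqrt (sqnorm x).

Lemma enorm_gt0 x : (0 < enorm x) = (x != 0).
Proof. by rewrite sqrtr_gt0 sqnorm_gt0. Qed.

Lemma sqr_enorm x : enorm x ^+ 2 = sqnorm x.
Proof. by rewrite sqr_sqrtr // sqnorm_ge0. Qed.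

Lemma enormZ (r : R) x : 0 < r -> enorm (r *: x) = r * enorm x.
Proof.
move=> r0; rewrite /enorm sqnormZ sqrtrM ?sqr_ge0 // sqrtr_sqr gtr0_norm //.
Qed.

Lemma sqnorm_normalize x : x != 0 -> sqnorm ((enorm x)^-1 *: x) = 1.
Proof.
move=> x0; rewrite sqnormZ exprVn sqr_enorm mulVf //.
by rewrite sqnorm_eq0.
Qed.

(** This is stereographic projection of [x / |x|] from [- pole], with numerator and denominator
    multiplied by [|x|]. Completeness of the frame gives the tangential part of [x], and Pythagoras
    its length. *)
Lemma stereo_inverse (f : @orthoframe R n N) x :
  0 < enorm x -> enorm x + \sum_c x 0 c * f ord0 0 c != 0 ->
  stereo f (\row_a ((\sum_c x 0 c * f (lift ord0 a) 0 c) /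
                    (enorm x + \sum_c x 0 c * f ord0 0 c))) =
  (enorm x)^-1 *: x.
Proof.
move=> r0; set xi := \sum_c x 0 c * f ord0 0 c => D0.
pose t (a : 'I_n) := \sum_c x 0 c * f (lift ord0 a) 0 c.
have tE c : \sum_a t a * f (lift ord0 a) 0 c = x 0 c - xi * f ord0 0 c.
  apply: (addIr (xi * f ord0 0 c)); rewrite subrK addrC.
  transitivity (\sum_k (\sum_d x 0 d * f k 0 d) * f k 0 c).
    by rewrite big_ord_recl.
  under eq_bigr do rewrite mulr_suml.
  rewrite exchange_big /= (bigD1 c) //= [X in _ + X]big1 ?addr0 => [|d dc].
    under eq_bigr do rewrite -mulrA.
    by rewrite -mulr_sumr frame_complete eqxx mulr1.
  under eq_bigr do rewrite -mulrA.
  by rewrite -mulr_sumr frame_complete (negbTE dc) mulr0.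
have tN : \sum_a t a ^+ 2 = enorm x ^+ 2 - xi ^+ 2.
  transitivity (\sum_c x 0 c * (\sum_a t a * f (lift ord0 a) 0 c)).
    under [RHS]eq_bigr do rewrite mulr_sumr.
    rewrite exchange_big; apply: eq_bigr => a _; rewrite expr2 {2}/t mulr_sumr.
    by apply: eq_bigr => c _; rewrite mulrCA.
  under eq_bigr do rewrite tE mulrBr.
  rewrite sumrB sqr_enorm; congr (_ - _).
  by rewrite expr2 {2}/xi mulr_sumr; apply: eq_bigr => c _; rewrite mulrCA.
set u := \row_a _.
have uN : 1 + sqnorm u = 2 * enorm x / (enorm x + xi).
  have -> : sqnorm u = (\sum_a t a ^+ 2) / (enorm x + xi) ^+ 2.
    by rewrite mulr_suml; apply: eq_bigr => a _; rewrite mxE exprMn exprVn.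
  by rewrite tN; field.
have r1 := lt0r_neq0 r0.
apply/rowP => c; rewrite !mxE /stereo_coord /stereo_scale uN.
have -> : tangent_sum f u c = (x 0 c - xi * f ord0 0 c) / (enorm x + xi).
  rewrite -tE mulr_suml; apply: eq_bigr => a _; rewrite mxE -/(t a).
  by rewrite mulrAC.
by field; rewrite r1.
Qed.

Variables (g : X -> R) (i : nat).
Hypothesis nN : n.+1 = N.
Hypothesis smooth_g :
  forall f : @orthoframe R n N, smooth setT (fun u => g (stereo f u)).

(* [g] matters only on the unit sphere. *)
Definition extension (x : X) : R := enorm x ^+ i * g ((enorm x)^-1 *: x).

Lemma extension_homogeneous : homogeneous (fun r => r ^+ i) extension.
Proof.
move=> r x r0 x0; rewrite /extension enormZ // exprMn -mulrA; congr (_ * (_ * g _)).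
rewrite scalerA; congr (_ *: _); rewrite invfM mulrAC mulVf ?mul1r //.
exact: lt0r_neq0.
Qed.

Lemma extension_sphere x : sqnorm x = 1 -> extension x = g x.
Proof.
by move=> x1; rewrite /extension /enorm x1 sqrtr1 expr1n mul1r invr1 scale1r.
Qed.

Lemma Ck_dot k (U : set X) (y : X) : open U ->
  Ck k U (fun x => \sum_c x 0 c * y 0 c).
Proof.
move=> oU; apply: (Ck_sum oU) => c; apply: (CkM oU); last exact: Ck_cst.
exact: Ck_coord.
Qed.

(** Only the pullbacks of [g] by charts are known to be smooth. Near [z] the chart centred at
    [z / |z|] is used: on the open half-space [W] its inverse is smooth, and [g (x / |x|)] is the
    pullback composed with that inverse. *)
Lemma extension_smooth : smooth U0 extension.
Proof.
move=> k; apply: Ck_pointwise => z /= z0.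
have [f fE] := orthoframe_exists nN (sqnorm_normalize z0).
pose xi (x : X) := \sum_c x 0 c * f ord0 0 c.
pose W : set X := [set x | 0 < xi x].
have oW : open W.
  apply: (@open_comp _ _ xi [set r : R | 0 < r]); last exact: open_gt.
  move=> x _.
  exact: (Ck_continuous (Ck_dot 0 (f ord0) openT)).
have W0 x : W x -> x != 0.
  rewrite /W /= => xi0; apply/eqP => x0; move: xi0; rewrite /xi big1 ?ltxx //.
  by move=> c _; rewrite x0 mxE mul0r.
have Wz : W z.
  rewrite /W /= /xi fE.
  have -> : \sum_c z 0 c * ((enorm z)^-1 *: z) 0 c = (enorm z)^-1 * sqnorm z.
    by rewrite mulr_sumr; apply: eq_bigr => c _; rewrite !mxE mulrCA expr2.
  by rewrite mulr_gt0 ?invr_gt0 ?enorm_gt0 ?sqnorm_gt0.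
apply: (@Ck_subset _ _ _ _ W) => [x -> //|].
pose s (a : 'I_n) (x : X) := (\sum_c x 0 c * f (lift ord0 a) 0 c) / (enorm x + xi x).
have CN k' : Ck k' W enorm.
  apply: (Ck_sqrt oW) => [x /W0|]; first by rewrite sqnorm_gt0.
  exact: smooth_sqnorm.
have Dgt0 x : W x -> 0 < enorm x + xi x.
  by move=> Wx; rewrite addr_gt0 // enorm_gt0 W0.
have Cs a : Ck k.+1 W (s a).
  apply: (CkM oW); first exact: Ck_dot.
  apply: (CkV oW) => [x /Dgt0 /lt0r_neq0 //|].
  by apply: (CkD oW) => //; exact: Ck_dot.
have Cg := @Ck_comp _ _ _ W setT oW openT k _ s Cs (smooth_g f k) (fun _ _ => I).
apply: (Ck_eq_on oW _ (CkM oW (CkX oW i (CN k)) Cg)) => x; rewrite inE => Wx.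
by rewrite /extension -(@stereo_inverse f x) ?enorm_gt0 ?W0 ?lt0r_neq0 ?Dgt0.
Qed.

(** At the centre the chart has velocities [2 tan_a] and accelerations [- 4 pole]. By completeness
    of the frame, the trace of the Hessian over the tangent directions is the Laplacian minus the
    second derivative along the pole. Euler's identity, for [F] and for its partial derivatives,
    evaluates the radial terms as [(d + 1) F] and [d (d + 1) F]. *)
Lemma laplacian_stereo (F : X -> R) (f : @orthoframe R n N) (d : nat) :
  smooth U0 F -> homogeneous (fun r => r ^+ d.+1) F ->
  \sum_a partial a (partial a (fun u => F (stereo f u))) 0 =
  4 * laplacian F (f ord0) - 4 * (d.+1%:R * (d%:R + n%:R)) * F (f ord0).
Proof.
move=> sF hF; have o0 := @open_punctured R N.
have y0 : f ord0 != 0 by rewrite -sqnorm_gt0 -(stereo0 f) sqnorm_stereo.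
have st0 u : U0 (\row_c stereo_coord f c u).
  by rewrite /= -[\row__ _]/(stereo f u) -sqnorm_gt0 sqnorm_stereo.
have sT c := smooth_stereo_coord f c.
have chain (G : X -> R) a u : smooth U0 G ->
    partial a (fun u => G (stereo f u)) u =
    \sum_c partial c G (stereo f u) * partial a (stereo_coord f c) u.
  move=> sG.
  by have [_] := partial_comp openT o0 a (fun c => sT c 1%N) (sG 1%N) I (st0 u).
have sdF c := smooth_partial c sF.
have sdFs c : smooth setT (fun u => partial c F (stereo f u)).
  by move=> k; exact: (Ck_comp openT o0 (fun b => sT b k.+1) (sdF c k)).
have sdT a c := smooth_partial a (sT c).
have d1 a c : partial a (stereo_coord f c) 0 = 2 * f (lift ord0 a) 0 c.
  by rewrite partial_stereo stereo_scale0 mxE !mulr0 !mul0r !add0r.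
have d2 a : partial a (partial a (fun u => F (stereo f u))) 0 =
    - 4 * \sum_c f ord0 0 c * partial c F (f ord0) +
    4 * \sum_c \sum_e partial e (partial c F) (f ord0) *
        (f (lift ord0 a) 0 e * f (lift ord0 a) 0 c).
  rewrite (_ : partial a (fun u => F (stereo f u)) = fun u =>
      \sum_c partial c F (stereo f u) * partial a (stereo_coord f c) u); last first.
    by apply/funext => u; exact: chain.
  rewrite (partial_sum _ _ openT) // => [|c]; last exact: smoothM openT _ _.
  rewrite !mulr_sumr -big_split; apply: eq_bigr => c _ /=.
  rewrite (partialM a (sdFs c) (sdT a c)) // chain // partial2_stereo0 stereo0 d1.
  rewrite [in LHS]mulr_sumr [in RHS]mulr_sumr; congr (_ + _); first by ring.
  by apply: eq_bigr => e _; rewrite d1; ring.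
have hdF c : homogeneous (fun r => r ^+ d) (partial c F).
  move=> r x r0 x0; rewrite (homogeneous_partial c sF hF) // exprSr mulfK //.
  exact: lt0r_neq0.
rewrite (eq_bigr _ (fun a _ => d2 a)) big_split /= sumr_const card_ord.
rewrite (Euler sF hF (is_derive_onepX d.+1)) // -mulr_sumr exchange_big /=.
rewrite (eq_bigr (fun c => partial c (partial c F) (f ord0)
   - d%:R * (f ord0 0 c * partial c F (f ord0)))) => [|c _]; last first.
  rewrite exchange_big /=.
  rewrite (eq_bigr (fun e => (e == c)%:R * partial e (partial c F) (f ord0) -
      f ord0 0 c * (f ord0 0 e * partial e (partial c F) (f ord0)))) => [|e _]; last first.
    rewrite -mulr_sumr -(frame_complete f e c) big_ord_recl /=; ring.
  rewrite sumrB -mulr_sumr (Euler (sdF c) (hdF c) (is_derive_onepX d)) //.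
  rewrite (bigD1 c) //= eqxx mul1r big1 ?addr0 => [|e ec]; last first.
    by rewrite (negbTE ec) mul0r.
  by ring.
rewrite sumrB -mulr_sumr (Euler sF hF (is_derive_onepX d.+1)) //.
rewrite -/(laplacian F (f ord0)) -mulr_natr; ring.
Qed.

(** Each unit vector is the centre of some chart, so the Laplacian vanishes on the unit sphere;
    being itself homogeneous with a nonzero multiplier, it vanishes everywhere. *)
Lemma extension_harmonic (d : nat) : i = d.+1 ->
  (forall f : @orthoframe R n N,
    \sum_a partial a (partial a (fun u => g (stereo f u))) 0 =
    - 4 * (i%:R * (d%:R + n%:R)) * g (f ord0)) ->
  harmonic extension.
Proof.
move=> iE lap_g.
have hF : homogeneous (fun r => r ^+ d.+1) extension.
  by rewrite -iE; exact: extension_homogeneous.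
have sF := extension_smooth.
have unit_harmonic y : sqnorm y = 1 -> laplacian extension y = 0.
  move=> y1; have [f fE] := orthoframe_exists nN y1.
  have := laplacian_stereo f sF hF.
  rewrite (_ : (fun u => extension (stereo f u)) = fun u => g (stereo f u)); last first.
    by apply/funext => u; rewrite extension_sphere // sqnorm_stereo.
  rewrite lap_g fE extension_sphere // -iE => E.
  have : 4 * laplacian extension y = 0.
    by apply: (addIr (- (4 * (i%:R * (d%:R + n%:R)) * g y))); rewrite -E add0r; ring.
  by move/eqP; rewrite mulf_eq0 pnatr_eq0 /= => /eqP.
move=> x x0; have r0 : 0 < enorm x by rewrite enorm_gt0.
have r1 : 0 < (enorm x)^-1 by rewrite invr_gt0.
have lap_hom : laplacian extension ((enorm x)^-1 *: x) =
    ((enorm x)^-1 ^+ d.+1 / (enorm x)^-1 / (enorm x)^-1) * laplacian extension x.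
  rewrite /laplacian mulr_sumr; apply: eq_bigr => a _.
  exact: (homogeneous_partial a (smooth_partial a sF) (homogeneous_partial a sF hF)).
move: lap_hom; rewrite unit_harmonic ?sqnorm_normalize // => /esym/eqP.
rewrite mulf_eq0 => /orP[|/eqP //].
by rewrite !mulf_eq0 !invr_eq0 expf_eq0 invr_eq0 (gt_eqF r0) andbF.
Qed.

End Extension.

(** * Lens spaces *)

Section SphereCoordinates.
Local Open Scope complex_scope.
Context {R : realType} {m : nat}.
Local Notation n := (2 * m).-1.
Local Notation X := 'rV[R]_(m + m).

Definition complex_row (x : X) : 'rV[R[i]]_m :=
  \row_j (x 0 (lshift m j) +i* x 0 (rshift m j)).

Lemma complex_rowN x : complex_row (- x) = - complex_row x.
Proof. by apply/rowP => j; rewrite !mxE. Qed.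

Lemma on_sphere_complex_row x : on_sphere (complex_row x) = (sqnorm x == 1).
Proof.
rewrite /on_sphere; have -> : \sum_j `|complex_row x 0 j| ^+ 2 = (sqnorm x)%:C.
  rewrite /sqnorm big_split_ord /= -big_split rmorph_sum /=.
  apply: eq_bigr => j _; rewrite mxE normc_def -rmorphXn /= sqr_sqrtr //.
  by rewrite addr_ge0 // sqr_ge0.
by apply/eqP/eqP => [[]|->].
Qed.

Lemma complex_row_surj (z : 'rV[R[i]]_m) : exists x, z = complex_row x.
Proof.
exists (row_mx (\row_j complex.Re (z 0 j)) (\row_j complex.Im (z 0 j))).
by apply/rowP => j; rewrite mxE row_mxEl row_mxEr !mxE; case: (z 0 j).
Qed.

Definition real_fun (G : sphere R m -> R) (x : X) : R :=
  if (insub (complex_row x) : option {z | on_sphere z}) is Some z then G z else 0.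

Lemma real_funE G (z : sphere R m) x : val z = complex_row x ->
  real_fun G x = G z.
Proof. by move=> zx; rewrite /real_fun -zx valK. Qed.

Variable f : @orthoframe R n (m + m).

Lemma stereo_sphere_subproof u : on_sphere (complex_row (stereo f u)).
Proof. by rewrite on_sphere_complex_row sqnorm_stereo. Qed.

Definition stereo_sphere (u : 'rV[R]_n) : sphere R m :=
  exist _ (complex_row (stereo f u)) (stereo_sphere_subproof u).

Lemma re_coord_stereo j : re_coord stereo_sphere j = stereo_coord f (lshift m j).
Proof. by apply/funext => u; rewrite /re_coord /= !mxE. Qed.

Lemma im_coord_stereo j : im_coord stereo_sphere j = stereo_coord f (rshift m j).
Proof. by apply/funext => u; rewrite /im_coord /= !mxE. Qed.

Lemma metric_stereo u : metric stereo_sphere u = (stereo_scale u ^+ 2)%:M.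
Proof.
apply/matrixP => a b; rewrite !mxE.
under eq_bigr do rewrite re_coord_stereo im_coord_stereo.
by rewrite big_split -mulr_natr -(stereo_metric f) big_split_ord.
Qed.

Lemma local_param_stereo : local_param setT stereo_sphere.
Proof.
split; first exact: openT.
  by move=> j; rewrite re_coord_stereo im_coord_stereo; split;
     exact: smooth_stereo_coord.
move=> u _; rewrite metric_stereo unitmxE det_scalar unitrX // unitfE.
by rewrite expf_eq0 /= gt_eqF // stereo_scale_gt0.
Qed.

Lemma local_laplacian_stereo0 (h : 'rV[R]_n -> R) : smooth setT h ->
  local_laplacian stereo_sphere h 0 =
  - 4^-1 * \sum_a partial a (partial a h) 0.
Proof.
move=> sh; rewrite /local_laplacian.
have sqrt_det v : Num.sqrt (\det (metric stereo_sphere v)) = stereo_scale v ^+ n.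
  rewrite metric_stereo det_scalar exprAC sqrtr_sqr.
  by rewrite ger0_norm // exprn_ge0 // ltW // stereo_scale_gt0.
(* [kappa] is the conformal factor to the power [n - 2], from [sqrt (det g)] times the inverse
   metric; the product form avoids truncated subtraction when [n = 1]. As a function of [|v|^2] it
   is critical at 0, so only second derivatives of [h] survive there. *)
pose kappa (v : 'rV[R]_n) : R := stereo_scale v ^+ n * ((1 + sqnorm v) / 2) ^+ 2.
have ss := @smooth_stereo_scale R n.
pose cQ := @smooth_cst R n setT.
have sQ : smooth setT (fun v : 'rV[R]_n => (1 + sqnorm v) / 2).
  move=> k; apply: (CkM openT); last exact: cQ.
  by apply: (CkD openT); [exact: cQ|exact: smooth_sqnorm openT _].
have crit (F : 'rV[R]_n -> R) k a : smooth setT F -> partial a F 0 = 0 ->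
    partial a (fun v => F v ^+ k) 0 = 0.
  move=> sF F0; elim: k => [|k IH].
    by rewrite (_ : (fun v => _) = fun=> 1) //; exact: derive_cst.
  rewrite (_ : (fun v => _) = fun v => F v * F v ^+ k); last first.
    by apply/funext => v; rewrite exprS.
  have sFk : smooth setT (fun v => F v ^+ k) by move=> k'; apply: (CkX openT).
  by rewrite (partialM a sF sFk) // IH F0 !mulr0 addr0.
have sk : smooth setT kappa.
  by move=> k; apply: (CkM openT); apply: (CkX openT); [exact: ss|exact: sQ].
have k0 a : partial a kappa 0 = 0.
  have s1 : smooth setT (fun v : 'rV[R]_n => stereo_scale v ^+ n).
    by move=> k; apply: (CkX openT); exact: ss.
  have s2 : smooth setT (fun v : 'rV[R]_n => ((1 + sqnorm v) / 2) ^+ 2).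
    by move=> k; apply: (CkX openT); exact: sQ.
  rewrite (partialM a s1 s2) // !crit ?mulr0 ?addr0 //.
    by rewrite partial_stereo_scale mxE mulr0.
  have sD : smooth setT (fun v : 'rV[R]_n => 1 + sqnorm v).
    by move=> k; apply: (CkD openT); [exact: cQ|exact: smooth_sqnorm openT _].
  rewrite (partialM a sD (cQ 2^-1)) // (partialD a (cQ 1) (smooth_sqnorm openT)) //.
  rewrite partial_sqnorm mxE mulr0 addr0.
  by rewrite [partial a (fun=> 2^-1) 0]derive_cst [partial a (fun=> 1) 0]derive_cst !mulr0 addr0.
have inner a v : Num.sqrt (\det (metric stereo_sphere v)) *
    \sum_b invmx (metric stereo_sphere v) a b * partial b h v =
    kappa v * partial a h v.
  rewrite sqrt_det metric_stereo invmx_scalar /kappa -mulrA; congr (_ * _).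
  rewrite (bigD1 a) //= big1 => [|b ba]; last first.
    by rewrite mxE eq_sym (negbTE ba) mulr0n mul0r.
  rewrite addr0 mxE eqxx mulr1n /stereo_scale; congr (_ * _).
  by field; rewrite gt_eqF // sqnormD1_gt0.
have -> : \sum_a partial a (fun v => Num.sqrt (\det (metric stereo_sphere v)) *
    \sum_b invmx (metric stereo_sphere v) a b * partial b h v) 0 =
    kappa 0 * \sum_a partial a (partial a h) 0.
  rewrite mulr_sumr; apply: eq_bigr => a _.
  rewrite (_ : (fun v => _) = fun v => kappa v * partial a h v); last first.
    by apply/funext => v; exact: inner.
  by rewrite (partialM a sk (smooth_partial a sh)) // k0 mulr0 addr0.
rewrite sqrt_det mulrA; congr (_ * _).
have /eqP E : sqnorm (0 : 'rV[R]_n) == 0 by rewrite sqnorm_eq0.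
rewrite /kappa stereo_scale0 E addr0.
by field; rewrite expf_neq0 // pnatr_eq0.
Qed.

End SphereCoordinates.

(** * Real eigenfunctions on the sphere that are invariant under the antipodal map *)

Section EvenEigenfunctions.
Context {R : realType} {m : nat}.
Local Notation n := (2 * m).-1.

Lemma even_eigenfunction_eq0 (G : sphere R m -> R) (i : nat) :
  (0 < m)%N -> odd i ->
  (forall U phi, local_param U phi -> smooth U (fun u => G (phi u))) ->
  (forall U phi, local_param U phi -> forall u, U u ->
     local_laplacian phi (fun u => G (phi u)) u =
     i%:R * (i%:R + 2 * m%:R - 2) * G (phi u)) ->
  (forall z w : sphere R m, val w = - val z -> G w = G z) ->
  forall z, G z = 0.
Proof.
move=> m0 i_odd sG lG evenG z.
have nN : n.+1 = (m + m)%N by rewrite prednK ?muln_gt0 // mul2n addnn.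
have [d iE] : exists d, i = d.+1 by case: i i_odd {lG} => // d _; exists d.
pose g := real_fun G.
have gE (f : @orthoframe R n (m + m)) u : g (stereo f u) = G (stereo_sphere f u).
  exact: real_funE.
have sg (f : @orthoframe R n (m + m)) : smooth setT (fun u => g (stereo f u)).
  rewrite (_ : (fun u => _) = fun u => G (stereo_sphere f u)).
    exact: sG (local_param_stereo f).
  by apply/funext => u; exact: gE.
have lg (f : @orthoframe R n (m + m)) :
    \sum_a partial a (partial a (fun u => g (stereo f u))) 0 =
    - 4 * (i%:R * (d%:R + n%:R)) * g (f ord0).
  have := lG _ _ (local_param_stereo f) 0 I.
  rewrite local_laplacian_stereo0; last exact: sG (local_param_stereo f).
  rewrite -gE stereo0.
  rewrite (_ : (fun u => G _) = fun u => g (stereo f u)); last first.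
    by apply/funext => u; rewrite gE.
  (* Here [i = d + 1] and [n = 2m - 1]. *)
  have -> : i%:R + 2 * m%:R - 2 = d%:R + n%:R :> R.
    have nE : (n%:R : R) = m%:R + m%:R - 1 by rewrite -natrD -nN -natr1 addrK.
    by rewrite iE -natr1 nE; ring.
  set S := \sum_a _ => E.
  transitivity (- 4 * (- 4^-1 * S)); first by field.
  by rewrite E; ring.
have sF := extension_smooth i nN sg.
have hF := @extension_homogeneous R (m + m) g i.
have lF := extension_harmonic nN sg iE lg.
(* The real dimension is even, so the excluded value 3 does not arise. *)
have n24 : (m + m = 2)%N \/ (4 <= m + m)%N.
  rewrite addnn; case: (ltngtP m 1) m0 => [|m1|->] // _; last by left.
  by right; rewrite (leq_double 2).
have evenF x : x != 0 -> extension g i (- x) = (- 1) ^+ i.+1 * extension g i x.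
  move=> x0; rewrite exprS -signr_odd i_odd expr1 mulrNN !mul1r.
  have E : enorm (- x) = enorm x.
    by rewrite /enorm -scaleN1r sqnormZ sqrrN expr1n mul1r.
  rewrite /extension E; congr (_ * _); rewrite scalerN.
  set y := _ *: x; have y1 : sqnorm y = 1 by exact: sqnorm_normalize.
  have yS : on_sphere (complex_row y) by rewrite on_sphere_complex_row y1.
  have yS' : on_sphere (complex_row (- y)).
    by rewrite on_sphere_complex_row -scaleN1r sqnormZ sqrrN expr1n mul1r y1.
  pose z1 : sphere R m := exist (fun z => on_sphere z) _ yS.
  pose z2 : sphere R m := exist (fun z => on_sphere z) _ yS'.
  rewrite /g (real_funE G (z := z1) (x := y)) // (real_funE G (z := z2) (x := - y)) //.
  by apply: evenG; exact: complex_rowN.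
have [x zx] := complex_row_surj (val z).
have x1 : sqnorm x = 1.
  by apply/eqP; rewrite -on_sphere_complex_row -zx; exact: (valP z).
have x0 : x != 0 by rewrite -sqnorm_gt0 x1.
rewrite -(real_funE G zx) -/g -(extension_sphere g i x1).
exact: harmonic_wrong_parity_eq0 n24 sF hF lF evenF x x0.
Qed.

End EvenEigenfunctions.

(** * Descent to the lens space: antipodal points are identified, and real and imaginary parts
    separate *)

Section LensEigenfunctions.
Local Open Scope complex_scope.
Local Open Scope quotient_scope.
Context {R : realType} {m : nat}.

Lemma expi_odd_pi k : odd k -> expi (pi * k%:R) = -1 :> R[i].
Proof.
move=> k_odd; rewrite -[k]odd_double_half k_odd natrD -mul2n natrM mulrDr mulr1.
have -> : pi * (2 * k./2%:R) = 2 * pi * k./2%:R :> R by ring.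
rewrite expiD expi_2pi mulr1 /expi cospi sinpi.
by apply/eqP; rewrite eq_complex /= oppr0 !eqxx.
Qed.

Variables (p : nat) (q : 'I_m -> nat).
Hypotheses (p_gt0 : (0 < p)%N) (p_even : ~~ odd p).
Hypothesis coprime_qp : forall j, coprime (q j) p.

Lemma lens_proj_antipode (z w : sphere R m) : val w = - val z ->
  lens_proj p q w = lens_proj p q z.
Proof.
(* The power [p / 2] of the generator multiplies coordinate [j] by [exp (i pi q_j)], which is -1 for
   odd [q_j]. *)
move=> wz; apply/esym/eqmodP; apply/asboolP; exists p./2.
apply: val_inj; apply/rowP => j; rewrite iter_lens_rotE wz mxE.
have pE : p = (2 * p./2)%N by rewrite mul2n -[LHS]odd_double_half (negbTE p_even).
have h0 : (p./2%:R : R) != 0.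
  by rewrite pnatr_eq0; apply: contraTneq p_gt0 => h; rewrite pE h.
have q_odd : odd (q j).
  apply: contraT => q_even; have := coprime_qp j; rewrite /coprime => /eqP E.
  have : (2 %| gcdn (q j) p)%N by rewrite dvdn_gcd !dvdn2 q_even p_even.
  by rewrite E.
rewrite /lens_phase expiX.
have -> : 2 * pi * (q j)%:R / p%:R *+ p./2 = pi * (q j)%:R :> R.
  by rewrite -[_ *+ _]mulr_natr {1}pE natrM; field.
by rewrite expi_odd_pi // mulN1r.
Qed.

(** [has_dim] is an equivalence, so the zero function must be shown to belong to the eigenspace. *)
Lemma lens_eigenspace0 (lam : R[i]) : lens_eigenspace (R := R) p q lam 0.
Proof.
split; first by move=> U phi _; split=> k; exact: Ck_cst.
have lap0 phi (u : 'rV[R]_(2 * m).-1) :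
    local_laplacian (R := R) (m := m) phi (fun=> 0) u = 0.
  rewrite /local_laplacian big1 ?mulr0 // => a _.
  rewrite (_ : (fun v => _) = fun=> 0); first exact: derive_cst.
  apply/funext => w; rewrite big1 ?mulr0 // => b _.
  by rewrite [partial b _ w]derive_cst mulr0.
move=> U phi _ u _; transitivity (0 : R[i]); first exact: mulr0.
rewrite (_ : pull_re 0 phi = fun=> 0) // (_ : pull_im 0 phi = fun=> 0) //.
by rewrite lap0.
Qed.

Lemma odd_lens_eigenfunction_eq0 (i : nat) (v : lens_space R p q -> R[i]^o) :
  (0 < m)%N -> odd i ->
  lens_eigenspace (R := R) p q (i%:R * (i%:R + 2 * m%:R - 2)) v -> v = 0.
Proof.
move=> hm i_odd [sv lv].
(* The eigenvalue is the image of a real number, so multiplication by it acts separately on real and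
   imaginary parts. *)
have lamE : i%:R * (i%:R + 2 * m%:R - 2) =
    (i%:R * (i%:R + 2 * m%:R - 2) : R)%:C :> R[i].
  by rewrite rmorphM rmorphB rmorphD rmorphM !rmorph_nat.
apply/funext => l.
have lapE U phi (locp : local_param U phi) u (Uu : U u) :
    local_laplacian phi (pull_re v phi) u =
      i%:R * (i%:R + 2 * m%:R - 2) * pull_re v phi u /\
    local_laplacian phi (pull_im v phi) u =
      i%:R * (i%:R + 2 * m%:R - 2) * pull_im v phi u.
  have ReIm (c : R) (w : R[i]) : complex.Re (c%:C * w) = c * complex.Re w /\
      complex.Im (c%:C * w) = c * complex.Im w.
    by case: w => x y /=; rewrite !mul0r subr0 addr0.
  pose w := v (lens_proj p q (phi u)).
  have E : (i%:R * (i%:R + 2 * m%:R - 2) : R)%:C * w =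
      local_laplacian phi (pull_re v phi) u +i* local_laplacian phi (pull_im v phi) u.
    by rewrite -lamE; exact: lv U phi locp u Uu.
  have [reE imE] := ReIm (i%:R * (i%:R + 2 * m%:R - 2)) w.
  by split; [move: reE|move: imE]; rewrite E.
have anti := lens_proj_antipode.
have reE := @even_eigenfunction_eq0 R m (fun z => complex.Re (v (lens_proj p q z)))
  i hm i_odd (fun U phi H => (sv U phi H).1)
  (fun U phi H u Uu => (lapE U phi H u Uu).1)
  (fun z w zw => congr1 (fun l => complex.Re (v l)) (anti z w zw)).
have imE := @even_eigenfunction_eq0 R m (fun z => complex.Im (v (lens_proj p q z)))
  i hm i_odd (fun U phi H => (sv U phi H).2)
  (fun U phi H u Uu => (lapE U phi H u Uu).2)
  (fun z w zw => congr1 (fun l => complex.Im (v l)) (anti z w zw)).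
rewrite -[l]reprK -/(lens_proj p q (repr l)).
by apply/eqP; rewrite eq_complex reE imE !eqxx.
Qed.

End LensEigenfunctions.

Theorem corollary4p1 (R : realType) (m : nat) (hm : (1 <= m)%N)
  (p : nat) (hp : (0 < p)%N) (p_even : ~~ odd p)
  (q : 'I_m -> nat) (hq : forall j, (0 < q j)%N)
  (hqp : forall j, coprime (q j) p)
  (i : nat) (hi : (0 < i)%N) (i_odd : odd i) :
  exists d : nat,
    has_dim (lens_eigenspace (R := R) p q (i%:R * (i%:R + 2 * m%:R - 2))) d /\
    ~~ odd d.
Proof.
exists 0%N; split=> //; exists (fun=> 0); split=> [c _ []//|v].
split=> [/(odd_lens_eigenfunction_eq0 hp p_even hqp hm i_odd) ->|[c ->]].
  by exists (fun=> 0); rewrite big_ord0.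
by rewrite big_ord0; exact: lens_eigenspace0.
Qed.
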